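(* Let $A \to B$ be a homomorphism of commutative DG rings, and let $(M, \rho)$ be a rigid DG module over $B$ relative to $A$. Assume that the adjunction morphism $B \to \operatorname{RHom}_{B}(M, M)$ in $\mathsf{D}(B)$ is an isomorphism. Then the only rigid automorphism of $(M, \rho)$ is the identity.
   Context: A commutative DG ring is a graded associative unital ring $A=\bigoplus_{i\le 0}A^i$ with a differential $\mathrm{d}$ of degree $1$ satisfying the graded Leibniz rule, such that $b\cdot a=(-1)^{ij}a\cdot b$ for $a\in A^i$, $b\in A^j$, and $a\cdot a=0$ for $a\in A^i$ with $i$ odd. $\mathsf{D}(B)$ is the derived category of DG $B$-modules (quasi-isomorphisms inverted). The adjunction morphism $B\to\operatorname{RHom}_B(M,M)$ is induced by the multiplication action of $B$. Squaring operation. A K-flat resolution of a homomorphism $A\to B$ of commutative DG rings is a homomorphism $\tilde A\to\tilde B$ of commutative DG rings, with $\tilde B$ K-flat as a DG $\tilde A$-module, together with a quasi-isomorphism $v:\tilde A\to A$ and a surjective quasi-isomorphism $w:\tilde B\to B$ making the square commute; such resolutions exist. Given one, define the functor $\operatorname{Sq}_{B/A}:\mathsf{D}(B)\to\mathsf{D}(B)$ by $$\operatorname{Sq}_{B/A}(M):=\operatorname{RHom}_{\tilde B\otimes_{\tilde A}\tilde B}(B,\,M\otimes^{\mathrm L}_{\tilde A}M).$$ Here $B$ is a DG module over $\tilde B\otimes_{\tilde A}\tilde B$ via multiplication followed by $w$; $M\otimes^{\mathrm L}_{\tilde A}M$ is $\tilde M\otimes_{\tilde A}\tilde M$ for a K-flat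 resolution $\tilde M\to M$ over $\tilde B$; the $B$-module structure on the RHom comes from the first argument; and a morphism $\phi:M\to N$ is sent to $\operatorname{RHom}(\mathrm{id}_B,\phi\otimes^{\mathrm L}\phi)$. It is a known theorem that this functor is independent of the K-flat resolution, up to a compatible system of canonical isomorphisms. A rigid DG module over $B$ relative to $A$ is a pair $(M,\rho)$ with $M$ a DG $B$-module and $\rho:M\to\operatorname{Sq}_{B/A}(M)$ an isomorphism in $\mathsf{D}(B)$. A rigid morphism $\phi:(M,\rho)\to(M',\rho')$ is a morphism $\phi:M\to M'$ in $\mathsf{D}(B)$ with $\rho'\circ\phi=\operatorname{Sq}_{B/A}(\phi)\circ\rho$. A rigid automorphism is a rigid morphism $(M,\rho)\to(M,\rho)$ that is an isomorphism. *)

(* Defs.v *)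
From HB Require Import structures.
From mathcomp Require Import all_boot all_order all_algebra.
From mathcomp Require Import boolp.
From mathcomp Require Import zify.
Set Implicit Arguments.
Unset Strict Implicit.
Unset Printing Implicit Defensive.
Import GRing.Theory.
Local Open Scope ring_scope.

(** Graded objects are families indexed by [int] (so a "DG module" is the family
    of its homogeneous components).  To avoid transports between, say, degrees
    [(i + j) + k] and [i + (j + k)], an operation landing in degree [i + j] takes
    the target degree [k] and a proof of [i + j = k] as arguments; these proofs
    are unique, since equality on [int] is decidable. *)

(** The Koszul sign (-1)^n; it acts on abelian groups through [_ *~ _]. *)
Definition ksign (n : int) : int := (-1) ^+ `|n|%N.

Lemma ksignE n : ksign n = if odd `|n|%N then -1 else 1.
Proof. by rewrite /ksign -signr_odd; case: odd. Qed.

Lemma odd_abszD (m n : int) : odd (absz (m + n)) = odd `|m|%N (+) odd `|n|%N.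
Proof. by lia. Qed.

Lemma odd_abszM (m n : int) : odd (absz (m * n)) = odd `|m|%N && odd `|n|%N.
Proof. by rewrite abszM oddM. Qed.

Definition signE := (ksignE, odd_abszD, odd_abszM).

Record cplx := Cplx {
  gr :> int -> zmodType;
  dif : forall {i j : int}, i + 1 = j -> gr i -> gr j;
  dif_add : forall i j (e : i + 1 = j) x y, dif e (x + y) = dif e x + dif e y;
  dif_dif : forall i j k (e : i + 1 = j) (e' : j + 1 = k) x, dif e' (dif e x) = 0
}.

Definition cocycle (X : cplx) (i : int) (x : X i) : Prop :=
  forall j (e : i + 1 = j), dif e x = 0.

Definition boundary (X : cplx) (i : int) (x : X i) : Prop :=
  exists j (e : j + 1 = i) (y : X j), dif e y = x.

Definition acyclic (X : cplx) : Prop :=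
  forall i (x : X i), cocycle x -> boundary x.

(** A chain map [f] induces injections, resp. surjections, on cohomology. *)
Definition quasi_iso (X Y : cplx) (f : forall i, X i -> Y i) : Prop :=
  (forall i (x : X i), cocycle x -> boundary (f i x) -> boundary x) /\
  (forall i (y : Y i), cocycle y ->
     exists x : X i, cocycle x /\ boundary (y - f i x)).

Record cdgring := CDGRing {
  ring_cplx :> cplx;
  mul : forall {i j k : int}, i + j = k -> ring_cplx i -> ring_cplx j -> ring_cplx k;
  one : ring_cplx 0;
  mul_addl : forall i j k (e : i + j = k) a b c,
    mul e (a + b) c = mul e a c + mul e b c;
  mul_addr : forall i j k (e : i + j = k) a b c,
    mul e a (b + c) = mul e a b + mul e a c;
  mul_assoc : forall i j k ij jk ijk (e1 : i + j = ij) (e2 : ij + k = ijk)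
      (e3 : j + k = jk) (e4 : i + jk = ijk) a b c,
    mul e2 (mul e1 a b) c = mul e4 a (mul e3 b c);
  mul_1l : forall i (e : 0 + i = i) a, mul e one a = a;
  mul_1r : forall i (e : i + 0 = i) a, mul e a one = a;
  dif_mul : forall i j k i' j' k' (e : i + j = k) (ei : i + 1 = i')
      (ej : j + 1 = j') (ek : k + 1 = k') (e1 : i' + j = k') (e2 : i + j' = k') a b,
    dif ek (mul e a b) = mul e1 (dif ei a) b + mul e2 a (dif ej b) *~ ksign i;
  mul_comm : forall i j k (e : i + j = k) (e' : j + i = k) a b,
    mul e' b a = mul e a b *~ ksign (i * j);
  mul_odd : forall i k (e : i + i = k) a, odd `|i|%N -> mul e a a = 0;
  ring_nonpos : forall i (a : ring_cplx i), 0 < i -> a = 0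
}.

Record cdghom (R S : cdgring) := CDGHom {
  rfun :> forall i, R i -> S i;
  rfun_add : forall i (a b : R i), rfun (a + b) = rfun a + rfun b;
  rfun_dif : forall i j (e : i + 1 = j) (a : R i), rfun (dif e a) = dif e (rfun a);
  rfun_one : rfun (one R) = one S;
  rfun_mul : forall i j k (e : i + j = k) (a : R i) (b : R j),
    rfun (mul e a b) = mul e (rfun a) (rfun b)
}.

Definition cdgid (R : cdgring) : cdghom R R.
Proof. by exists (fun i a => a). Defined.

Definition cdgcomp (R S T : cdgring) (g : cdghom S T) (f : cdghom R S) : cdghom R T.
Proof.
exists (fun i a => g i (f i a)).
- by move=> *; rewrite !rfun_add.
- by move=> *; rewrite !rfun_dif.
- by rewrite !rfun_one.
- by move=> *; rewrite !rfun_mul.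
Defined.

Record dgmod (R : cdgring) := DGMod {
  mod_cplx :> cplx;
  act : forall {i j k : int}, i + j = k -> R i -> mod_cplx j -> mod_cplx k;
  act_addl : forall i j k (e : i + j = k) a b x,
    act e (a + b) x = act e a x + act e b x;
  act_addr : forall i j k (e : i + j = k) a x y,
    act e a (x + y) = act e a x + act e a y;
  act_assoc : forall i j k ij jk ijk (e1 : i + j = ij) (e2 : ij + k = ijk)
      (e3 : j + k = jk) (e4 : i + jk = ijk) a b x,
    act e2 (mul e1 a b) x = act e4 a (act e3 b x);
  act_1 : forall i (e : 0 + i = i) x, act e (one R) x = x;
  dif_act : forall i j k i' j' k' (e : i + j = k) (ei : i + 1 = i')
      (ej : j + 1 = j') (ek : k + 1 = k') (e1 : i' + j = k') (e2 : i + j' = k') a x,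
    dif ek (act e a x) = act e1 (dif ei a) x + act e2 a (dif ej x) *~ ksign i
}.

Record dgmor (R : cdgring) (M N : dgmod R) := DGMor {
  mfun :> forall i, M i -> N i;
  mfun_add : forall i (x y : M i), mfun (x + y) = mfun x + mfun y;
  mfun_dif : forall i j (e : i + 1 = j) (x : M i), mfun (dif e x) = dif e (mfun x);
  mfun_act : forall i j k (e : i + j = k) (a : R i) (x : M j),
    mfun (act e a x) = act e a (mfun x)
}.

Definition dgid (R : cdgring) (M : dgmod R) : dgmor M M.
Proof. by exists (fun i x => x). Defined.

Definition dgcomp (R : cdgring) (M N P : dgmod R) (g : dgmor N P) (f : dgmor M N) :
  dgmor M P.
Proof.
exists (fun i x => g i (f i x)).
- by move=> *; rewrite !mfun_add.
- by move=> *; rewrite !mfun_dif.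
- by move=> *; rewrite !mfun_act.
Defined.

Definition self_mod (R : cdgring) : dgmod R.
Proof.
exists (ring_cplx R) (fun i j k e => @mul R i j k e).
- exact: mul_addl.
- exact: mul_addr.
- exact: mul_assoc.
- exact: mul_1l.
- exact: dif_mul.
Defined.

Definition res (R S : cdgring) (f : cdghom R S) (M : dgmod S) : dgmod R.
Proof.
exists (mod_cplx M) (fun i j k e a x => act e (f i a) x).
- by move=> *; rewrite rfun_add act_addl.
- by move=> *; rewrite act_addr.
- by move=> *; rewrite rfun_mul; apply: act_assoc.
- by move=> *; rewrite rfun_one act_1.
- by move=> *; rewrite rfun_dif; apply: dif_act.
Defined.

Definition res_mor (R S : cdgring) (f : cdghom R S) (M N : dgmod S) (g : dgmor M N) :
  dgmor (res f M) (res f N).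
Proof.
exists (fun i (x : res f M i) => g i x : res f N i).
- by move=> i x y; exact: (mfun_add g x y).
- by move=> i j e x; exact: (mfun_dif g e x).
- by move=> i j k e a x; exact: (mfun_act g e (f i a) x).
Defined.

Lemma act0r (T : cdgring) (M : dgmod T) i j k (e : i + j = k) (a : T i) :
  act e a (0 : M j) = 0.
Proof. by apply: (addIr (act e a 0)); rewrite -act_addr !add0r. Qed.

Lemma act0l (T : cdgring) (M : dgmod T) i j k (e : i + j = k) (x : M j) :
  act e (0 : T i) x = 0.
Proof. by apply: (addIr (act e 0 x)); rewrite -act_addl !add0r. Qed.

Lemma actNl (T : cdgring) (M : dgmod T) i j k (e : i + j = k) (a : T i) (x : M j) :
  act e (- a) x = - act e a x.
Proof. by apply: (addIr (act e a x)); rewrite -act_addl !addNr act0l. Qed.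

Lemma act_signl (T : cdgring) (M : dgmod T) i j k (e : i + j = k) (a : T i) (x : M j) n :
  act e (a *~ ksign n) x = act e a x *~ ksign n.
Proof. by rewrite ksignE; case: odd; rewrite ?mulrN1z ?mulr1z ?actNl. Qed.

Lemma actNr (T : cdgring) (M : dgmod T) i j k (e : i + j = k) (a : T i) (x : M j) :
  act e a (- x) = - act e a x.
Proof. by apply: (addIr (act e a x)); rewrite -act_addr !addNr act0r. Qed.

Lemma act_sign (T : cdgring) (M : dgmod T) i j k (e : i + j = k) (a : T i) (x : M j) n :
  act e a (x *~ ksign n) = act e a x *~ ksign n.
Proof. by rewrite ksignE; case: odd; rewrite ?mulrN1z ?mulr1z ?actNr. Qed.

Lemma dif0 (C : cplx) i j (e : i + 1 = j) : dif e (0 : C i) = 0.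
Proof. by apply: (addIr (dif e 0)); rewrite -dif_add !add0r. Qed.

Lemma difN (C : cplx) i j (e : i + 1 = j) (x : C i) : dif e (- x) = - dif e x.
Proof. by apply: (addIr (dif e x)); rewrite -dif_add !addNr dif0. Qed.

Lemma dif_sign (C : cplx) i j (e : i + 1 = j) (x : C i) n :
  dif e (x *~ ksign n) = dif e x *~ ksign n.
Proof. by rewrite ksignE; case: odd; rewrite ?mulrN1z ?mulr1z ?difN. Qed.

Lemma mfun0 (T : cdgring) (M N : dgmod T) (g : dgmor M N) i : g i 0 = 0.
Proof. by apply: (addIr (g i 0)); rewrite -mfun_add !add0r. Qed.

Lemma mfunN (T : cdgring) (M N : dgmod T) (g : dgmor M N) i (x : M i) :
  g i (- x) = - g i x.
Proof. by apply: (addIr (g i x)); rewrite -mfun_add !addNr mfun0. Qed.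

Lemma mor_sign (T : cdgring) (M N : dgmod T) (g : dgmor M N) i (x : M i) n :
  g i (x *~ ksign n) = g i x *~ ksign n.
Proof. by rewrite ksignE; case: odd; rewrite ?mulrN1z ?mulr1z ?mfunN. Qed.

Lemma act_comm (T : cdgring) (M : dgmod T) i j k ik jk ijk (e1 : i + k = ik)
    (e2 : j + ik = ijk) (e3 : j + k = jk) (e4 : i + jk = ijk) (a : T i) (b : T j) (x : M k) :
  act e2 b (act e1 a x) = act e4 a (act e3 b x) *~ ksign (i * j).
Proof.
have e5 : (j + i) + k = ijk by lia.
have e6 : (i + j) + k = ijk by lia.
rewrite -(act_assoc erefl e5) (mul_comm (addrC i j)).
by rewrite act_signl (act_assoc _ _ e3 e4).
Qed.

(** For a homomorphism [f : R -> S], a DG S-module [X] and a DG R-module [Y], the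
    R-linear maps from [X] to [Y] form a DG S-module, with [S] acting through the
    first argument: [(s h)(x) = (-1)^(|s||h|) h(s x)]. *)

Section Hom.
Variables (R S : cdgring) (f : cdghom R S) (X : dgmod S) (Y : dgmod R).

Record homel (i : int) := Homel {
  hfun : forall {j k : int}, i + j = k -> X j -> Y k;
  hfun_add : forall j k (e : i + j = k) x y, hfun e (x + y) = hfun e x + hfun e y;
  hfun_act : forall a j k aj ak (e1 : a + j = aj) (e2 : i + aj = ak)
      (e3 : i + j = k) (e4 : a + k = ak) (r : R a) (x : X j),
    hfun e2 (act e1 (f a r) x) = act e4 r (hfun e3 x) *~ ksign (i * a)
}.

HB.instance Definition _ i := gen_eqMixin (homel i).
HB.instance Definition _ i := gen_choiceMixin (homel i).

Lemma homel_eq i (g h : homel i) :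
  (forall j k (e : i + j = k) x, hfun g e x = hfun h e x) -> g = h.
Proof.
case: g h => [g ga gl] [h ha hl] /= gh.
have E : g = h.
  apply: functional_extensionality_dep => j.
  apply: functional_extensionality_dep => k.
  apply: functional_extensionality_dep => e.
  by apply: functional_extensionality_dep => x; exact: gh.
by subst h; congr Homel; exact: Prop_irrelevance.
Qed.

Lemma hfun0 i (g : homel i) j k (e : i + j = k) : hfun g e 0 = 0.
Proof. by apply: (addIr (hfun g e 0)); rewrite -hfun_add !add0r. Qed.

Lemma hfunN i (g : homel i) j k (e : i + j = k) x : hfun g e (- x) = - hfun g e x.
Proof. by apply: (addIr (hfun g e x)); rewrite -hfun_add !addNr hfun0. Qed.

Definition hom0 i : homel i.
Proof.
exists (fun j k e x => 0).
- by move=> *; rewrite addr0.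
- by move=> *; rewrite act0r mul0rz.
Defined.

Definition homD i (g h : homel i) : homel i.
Proof.
exists (fun j k e x => hfun g e x + hfun h e x).
- by move=> *; rewrite !hfun_add addrACA.
- move=> a j k aj ak e1 e2 e3 e4 r x.
  by rewrite !(hfun_act _ e1 e2 e3 e4) act_addr mulrzDl.
Defined.

Definition homN i (g : homel i) : homel i.
Proof.
exists (fun j k e x => - hfun g e x).
- by move=> *; rewrite hfun_add opprD.
- move=> a j k aj ak e1 e2 e3 e4 r x.
  by rewrite (hfun_act _ e1 e2 e3 e4) actNr mulNrz.
Defined.

Lemma homDA i : associative (@homD i).
Proof. by move=> *; apply: homel_eq => * /=; rewrite addrA. Qed.
Lemma homDC i : commutative (@homD i).
Proof. by move=> *; apply: homel_eq => * /=; rewrite addrC. Qed.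
Lemma hom0D i : left_id (hom0 i) (@homD i).
Proof. by move=> *; apply: homel_eq => * /=; rewrite add0r. Qed.
Lemma homND i : left_inverse (hom0 i) (@homN i) (@homD i).
Proof. by move=> *; apply: homel_eq => * /=; rewrite addNr. Qed.

HB.instance Definition _ i :=
  GRing.isZmodule.Build (homel i) (@homDA i) (@homDC i) (@hom0D i) (@homND i).

Lemma hfunE_add i (g h : homel i) j k (e : i + j = k) x :
  hfun (g + h) e x = hfun g e x + hfun h e x.
Proof. by []. Qed.

Lemma hfunE_opp i (g : homel i) j k (e : i + j = k) x :
  hfun (- g) e x = - hfun g e x.
Proof. by []. Qed.

Lemma hfunE_sign i (g : homel i) n j k (e : i + j = k) x :
  hfun (g *~ ksign n) e x = hfun g e x *~ ksign n.
Proof. by rewrite ksignE; case: odd; rewrite ?mulrN1z ?mulr1z. Qed.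

Lemma hfun_sign i (g : homel i) j k (e : i + j = k) x n :
  hfun g e (x *~ ksign n) = hfun g e x *~ ksign n.
Proof. by rewrite ksignE; case: odd; rewrite ?mulrN1z ?mulr1z ?hfunN. Qed.

(* The value of [h] on [x] does not depend on how the degree of [x] is written. *)
Lemma hfun_act_irr i (h : homel i) a j k l l' (e1 : a + j = l) (e2 : i + l = k)
    (e1' : a + j = l') (e2' : i + l' = k) (s : S a) x :
  hfun h e2 (act e1 s x) = hfun h e2' (act e1' s x).
Proof. by subst l; subst l'; rewrite (eq_irrelevance e2 e2'). Qed.

Lemma hfun_dif_irr i (h : homel i) j k l l' (e1 : j + 1 = l) (e2 : i + l = k)
    (e1' : j + 1 = l') (e2' : i + l' = k) x :
  hfun h e2 (dif e1 x) = hfun h e2' (dif e1' x).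
Proof. by subst l; subst l'; rewrite (eq_irrelevance e2 e2'). Qed.

Lemma dif_hfun_irr i (h : homel i) j k l l' (e1 : i + j = l) (e2 : l + 1 = k)
    (e1' : i + j = l') (e2' : l' + 1 = k) x :
  dif e2 (hfun h e1 x) = dif e2' (hfun h e1' x).
Proof. by subst l; subst l'; rewrite (eq_irrelevance e2 e2'). Qed.

Fact homdif_e1 (i i' j k : int) : i + 1 = i' -> i' + j = k -> i + j = k - 1.
Proof. by lia. Qed.
Fact homdif_e2 (i i' j k : int) : i + 1 = i' -> i' + j = k -> i + (j + 1) = k.
Proof. by lia. Qed.

Definition homdif i i' (ei : i + 1 = i') (h : homel i) : homel i'.
Proof.
exists (fun j k e x =>
  dif (subrK 1 k) (hfun h (homdif_e1 ei e) x) -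
  hfun h (homdif_e2 ei e) (dif (erefl (j + 1)) x) *~ ksign i).
- move=> j k e x y; rewrite !(hfun_add, dif_add) mulrzDl opprD.
  by rewrite addrACA.
- move=> a j k aj ak e1 e2 e3 e4 r x.
  have ea : a + (k - 1) = ak - 1 by lia.
  have ea' : (a + 1) + (k - 1) = ak by lia.
  have ej : (a + 1) + j = aj + 1 by lia.
  have ej' : a + (j + 1) = aj + 1 by lia.
  have eh : i + aj = ak - 1 by lia.
  rewrite (hfun_act h _ _ (homdif_e1 ei e3) ea) dif_sign.
  rewrite (dif_act _ erefl (subrK 1 k) _ ea' e4).
  rewrite (dif_act _ erefl (erefl (j + 1)) _ ej ej') -rfun_dif.
  rewrite hfun_add hfun_sign.
  rewrite (hfun_act h ej _ (homdif_e1 ei e3) ea').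
  rewrite (hfun_act h ej' _ (homdif_e2 ei e3) e4).
  rewrite act_addr actNr act_sign.
  move: (act ea' _ _) (act e4 _ (dif _ _)) (act e4 _ (hfun _ _ _)) => p q u.
  rewrite -ei !signE.
  by do 2!case: odd; rewrite /= ?(mulrN1z, mulr1z, opprD, opprK) addrACA
    ?(addrN, addNr) add0r.
Defined.

Fact homact_e (i j k l m : int) : i + j = k -> k + l = m -> j + (i + l) = m.
Proof. by lia. Qed.

Definition homact i j k (e : i + j = k) (b : S i) (h : homel j) : homel k.
Proof.
exists (fun l m e' x =>
  hfun h (homact_e e e') (act (erefl (i + l)) b x) *~ ksign (i * j)).
- by move=> *; rewrite act_addr hfun_add mulrzDl.
- move=> a l m al am e1 e2 e3 e4 r x.
  have e5 : a + (i + l) = i + al by lia.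
  rewrite (act_comm e1 _ erefl e5).
  rewrite hfun_sign (hfun_act h e5 _ (homact_e e e3) e4) act_sign.
  rewrite -!mulrzA; congr (_ *~ _); rewrite -e !signE.
  by do 3!case: odd.
Defined.

Lemma homdif_add i i' (ei : i + 1 = i') g h :
  homdif ei (g + h) = homdif ei g + homdif ei h.
Proof.
apply: homel_eq => j k e x.
by rewrite /= dif_add mulrzDl opprD addrACA.
Qed.

Lemma homdif_dif i j k (e : i + 1 = j) (e' : j + 1 = k) h :
  homdif e' (homdif e h) = 0.
Proof.
apply: homel_eq => l m el x /=.
rewrite dif_add difN dif_sign dif_dif !dif_dif hfun0 mul0rz oppr0.
rewrite (dif_hfun_irr _ _ _ (homdif_e1 e (homdif_e2 e' el)) (subrK 1 m)).
move: (dif (subrK 1 m) _) => p; rewrite -e !signE.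
by case: odd; rewrite /= ?(mulrN1z, mulr1z, opprK) ?subr0 add0r ?addr0 ?addNr ?addrN.
Qed.

Definition hom_cplx : cplx := Cplx homdif_add homdif_dif.

Definition dgHom : dgmod S.
Proof.
exists hom_cplx homact.
- move=> i j k e a b h; apply: homel_eq => l m el x.
  by rewrite /= act_addl hfun_add mulrzDl.
- move=> i j k e a g h; apply: homel_eq => l m el x.
  by rewrite /= mulrzDl.
- move=> i j k ij jk ijk e1 e2 e3 e4 a b h; apply: homel_eq => l m el x /=.
  have e5 : j + (i + l) = ij + l by lia.
  have e6 : (j + i) + l = ij + l by lia.
  have e7 : j + i = ij by lia.
  rewrite (mul_comm e7) act_signl (act_assoc _ _ erefl e5).
  rewrite hfun_sign (hfun_act_irr _ _ _ erefl (homact_e e3 (homact_e e4 el))).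
  rewrite -!mulrzA; congr (_ *~ _); rewrite -e1 -e3 !signE.
  by do 3!case: odd.
- move=> i e h; apply: homel_eq => l m el x /=.
  have e1 : i + l = m by [].
  have e0 : 0 + l = l by rewrite add0r.
  have -> : hfun h (homact_e e el) (act erefl (one S) x) = hfun h el (act e0 (one S) x).
    exact: hfun_act_irr.
  by rewrite act_1 mul0r mulr1z.
- move=> i j k i' j' k' e ei ej ek e1 e2 a h; apply: homel_eq => l m el x.
  rewrite hfunE_add hfunE_sign /=.
  have a1 : i' + l = i + l + 1 by lia.
  have a2 : i + (l + 1) = i + l + 1 by lia.
  rewrite (dif_act erefl ei erefl erefl a1 a2) hfun_add hfun_sign dif_sign.
  rewrite (hfun_act_irr _ a1 _ (erefl _) (homact_e e1 el)).
  rewrite (hfun_act_irr _ a2 _ (erefl _) (homact_e e (homdif_e2 ek el))).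
  rewrite (eq_irrelevance (homdif_e1 ej _) (homact_e e (homdif_e1 ek el))).
  move: (dif _ _) (hfun _ _ (act _ (dif ei a) x)) (hfun _ _ (act _ a (dif _ _))) => p q u.
  rewrite -e -ei -ej !signE.
  by case: odd; case: odd;
    rewrite /= ?(mulrN1z, mulr1z, opprD, opprK) [RHS]addrCA ?(addKr, addNKr).
Defined.

End Hom.

Definition hom_map_el (R S : cdgring) (f : cdghom R S) (X : dgmod S) (Y Y' : dgmod R)
  (g : dgmor Y Y') i (h : homel f X Y i) : homel f X Y' i.
Proof.
exists (fun j k e x => g k (hfun h e x)).
- by move=> *; rewrite hfun_add mfun_add.
- move=> a j k aj ak e1 e2 e3 e4 r x.
  by rewrite (hfun_act h e1 e2 e3 e4) mor_sign mfun_act.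
Defined.

Definition hom_map (R S : cdgring) (f : cdghom R S) (X : dgmod S) (Y Y' : dgmod R)
  (g : dgmor Y Y') : dgmor (dgHom f X Y) (dgHom f X Y').
Proof.
exists (fun i h => hom_map_el g h : dgHom f X Y' i).
- by move=> i h h'; apply: homel_eq => j k e x /=; rewrite mfun_add.
- move=> i i' ei h; apply: homel_eq => j k e x /=.
  by rewrite mfun_add mfunN mor_sign mfun_dif.
- by move=> i j k e b h; apply: homel_eq => l m el x /=; rewrite mor_sign.
Defined.

Definition adjunction_el (R : cdgring) (M J : dgmod R) (g : dgmor M J) i
  (b : self_mod R i) : homel (cdgid R) M J i.
Proof.
exists (fun j k e x => g k (act e b x)).
- by move=> *; rewrite act_addr mfun_add.
- move=> a j k aj ak e1 e2 e3 e4 r x.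
  by rewrite (act_comm e1 e2 e3 e4) mor_sign mfun_act mulrC.
Defined.

(** For [g : M -> J], the morphism [R -> Hom_R(M, J)] sending [r] to
    [x |-> g (r x)]. *)
Definition adjunction_map (R : cdgring) (M J : dgmod R) (g : dgmor M J) :
  dgmor (self_mod R) (dgHom (cdgid R) M J).
Proof.
exists (fun i b => adjunction_el g b : dgHom (cdgid R) M J i).
- by move=> i b c; apply: homel_eq => j k e x /=; rewrite act_addl mfun_add.
- move=> i i' ei b; apply: homel_eq => j k e x /=.
  rewrite -mfun_dif.
  rewrite (dif_act _ ei (erefl (j + 1)) _ e (homdif_e2 ei e)).
  by rewrite mfun_add mor_sign addrK.
- move=> i j k e c b; apply: homel_eq => l m el x /=.
  have e1 : j + l = m - i by lia.
  have e2 : i + (m - i) = m by lia.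
  rewrite (act_comm erefl _ e1 e2) mor_sign -mulrzA (act_assoc _ _ e1 e2).
  by rewrite !signE; case: odd; case: odd; rewrite /= ?mulr1z.
Defined.

(** Left modules are also right modules, by [m a = (-1)^(|a||m|) a m]; this is
    the source of the sign in the balancing condition. *)

Record bimap (A : cdgring) (M N : dgmod A) (G : int -> zmodType) := Bimap {
  bfun :> forall i j k : int, i + j = k -> M i -> N j -> G k;
  bfun_addl : forall i j k (e : i + j = k) x y z,
    bfun e (x + y) z = bfun e x z + bfun e y z;
  bfun_addr : forall i j k (e : i + j = k) x y z,
    bfun e x (y + z) = bfun e x y + bfun e x z;
  bfun_bal : forall a i j ai aj k (e1 : a + i = ai) (e2 : a + j = aj)
      (e3 : ai + j = k) (e4 : i + aj = k) (r : A a) x y,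
    bfun e3 (act e1 r x) y = bfun e4 x (act e2 r y) *~ ksign (a * i)
}.

Definition factors (A : cdgring) (M N : dgmod A) (T G : int -> zmodType)
    (t : bimap M N T) (g : bimap M N G) (h : forall k, T k -> G k) : Prop :=
  (forall k (x y : T k), h k (x + y) = h k x + h k y) /\
  (forall i j k (e : i + j = k) x y, h k (t i j k e x y) = g i j k e x y).

(** [T] is the tensor product of [M] and [N] over [A]: as a graded abelian group
    it has the universal property, and its differential is the usual one. *)
Record tensor (A : cdgring) (M N : dgmod A) (T : cplx) := Tensor {
  tens : bimap M N T;
  tens_univ : forall (G : int -> zmodType) (g : bimap M N G),
    exists h, factors tens g h /\
      forall h', factors tens g h' -> forall k x, h' k x = h k x;
  tens_dif : forall i j k i' j' k' (e : i + j = k) (ei : i + 1 = i')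
      (ej : j + 1 = j') (ek : k + 1 = k') (e1 : i' + j = k') (e2 : i + j' = k') x y,
    dif ek (tens _ _ _ e x y) =
    tens _ _ _ e1 (dif ei x) y + tens _ _ _ e2 x (dif ej y) *~ ksign i
}.

Notation "x '⊗[' t , e ] y" := (tens t _ _ _ e x y)
  (at level 40, t at level 200, e at level 200, left associativity).

Record tensor_ring (R S : cdgring) (f : cdghom R S) := TensorRing {
  tring :> cdgring;
  tring_tens : tensor (res f (self_mod S)) (res f (self_mod S)) tring;
  tring_one : one S ⊗[tring_tens, addr0 0] one S = one tring;
  tring_mul : forall i j k l ij kl ik jl n (e1 : i + j = ij) (e2 : k + l = kl)
      (e3 : i + k = ik) (e4 : j + l = jl) (e5 : ij + kl = n) (e6 : ik + jl = n)
      (a : S i) (b : S j) (c : S k) (d : S l),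
    mul e5 (a ⊗[tring_tens, e1] b) (c ⊗[tring_tens, e2] d) =
    (mul e3 a c ⊗[tring_tens, e6] mul e4 b d) *~ ksign (j * k)
}.

Record tensor_sq (R S : cdgring) (f : cdghom R S) (E : tensor_ring f) (P : dgmod S) :=
TensorSq {
  tsq :> dgmod E;
  tsq_tens : tensor (res f P) (res f P) tsq;
  tsq_act : forall i j k l ij kl ik jl n (e1 : i + j = ij) (e2 : k + l = kl)
      (e3 : i + k = ik) (e4 : j + l = jl) (e5 : ij + kl = n) (e6 : ik + jl = n)
      (a : S i) (b : S j) (x : P k) (y : P l),
    act e5 (a ⊗[tring_tens E, e1] b) (x ⊗[tsq_tens, e2] y) =
    (act e3 a x ⊗[tsq_tens, e6] act e4 b y) *~ ksign (j * k)
}.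

Definition is_tensor_sq_mor (R S : cdgring) (f : cdghom R S) (E : tensor_ring f)
    (P Q : dgmod S) (TP : tensor_sq E P) (TQ : tensor_sq E Q)
    (g : dgmor P Q) (F : dgmor TP TQ) : Prop :=
  forall i j k (e : i + j = k) (x : P i) (y : P j),
    F k (x ⊗[tsq_tens TP, e] y) = g i x ⊗[tsq_tens TQ, e] g j y.

Definition kflat (R : cdgring) (P : dgmod R) : Prop :=
  forall N : dgmod R, acyclic N -> forall T : cplx, tensor P N T -> acyclic T.

Definition kproj (R : cdgring) (P : dgmod R) : Prop :=
  forall N : dgmod R, acyclic N -> acyclic (dgHom (cdgid R) P N).

Definition kinj (R : cdgring) (I : dgmod R) : Prop :=
  forall N : dgmod R, acyclic N -> acyclic (dgHom (cdgid R) N I).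

Record kinj_resolution (R : cdgring) (M : dgmod R) := KInjResolution {
  kinj_mod :> dgmod R;
  kinj_map : dgmor M kinj_mod;
  kinj_qi : quasi_iso kinj_map;
  kinj_kinj : kinj kinj_mod
}.

Record kflat_resolution (R : cdgring) (M : dgmod R) := KFlatResolution {
  kflat_mod :> dgmod R;
  kflat_map : dgmor kflat_mod M;
  kflat_qi : quasi_iso kflat_map;
  kflat_kflat : kflat kflat_mod
}.

Record kproj_resolution (R : cdgring) (M : dgmod R) := KProjResolution {
  kproj_mod :> dgmod R;
  kproj_map : dgmor kproj_mod M;
  kproj_qi : quasi_iso kproj_map;
  kproj_kproj : kproj kproj_mod
}.

(** The derived category D(R) is the localization of the category of DG R-modules at the
    quasi-isomorphisms: its morphisms are formal composites of morphisms of DG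
    modules and inverses of quasi-isomorphisms, and [deq] is equality of such
    morphisms, the congruence generated by the evident relations. *)

Inductive dmor (R : cdgring) : dgmod R -> dgmod R -> Type :=
| Dmor M N : dgmor M N -> dmor M N
| Dinv M N (s : dgmor M N) : quasi_iso s -> dmor N M
| Dcomp M N P : dmor N P -> dmor M N -> dmor M P.

Definition Did (R : cdgring) (M : dgmod R) : dmor M M := Dmor (dgid M).

Inductive deq (R : cdgring) : forall M N : dgmod R, dmor M N -> dmor M N -> Prop :=
| deq_refl M N (phi : dmor M N) : deq phi phi
| deq_sym M N (phi psi : dmor M N) : deq phi psi -> deq psi phi
| deq_trans M N (phi psi chi : dmor M N) : deq phi psi -> deq psi chi -> deq phi chi
| deq_congr M N P (phi phi' : dmor N P) (psi psi' : dmor M N) :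
    deq phi phi' -> deq psi psi' -> deq (Dcomp phi psi) (Dcomp phi' psi')
| deq_assoc M N P Q (phi : dmor P Q) (psi : dmor N P) (chi : dmor M N) :
    deq (Dcomp phi (Dcomp psi chi)) (Dcomp (Dcomp phi psi) chi)
| deq_id_l M N (phi : dmor M N) : deq (Dcomp (Did N) phi) phi
| deq_id_r M N (phi : dmor M N) : deq (Dcomp phi (Did M)) phi
| deq_comp M N P (g : dgmor N P) (h : dgmor M N) :
    deq (Dmor (dgcomp g h)) (Dcomp (Dmor g) (Dmor h))
| deq_inv_l M N (s : dgmor M N) (hs : quasi_iso s) :
    deq (Dcomp (Dinv hs) (Dmor s)) (Did M)
| deq_inv_r M N (s : dgmor M N) (hs : quasi_iso s) :
    deq (Dcomp (Dmor s) (Dinv hs)) (Did N).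

Definition is_diso (R : cdgring) (M N : dgmod R) (phi : dmor M N) : Prop :=
  exists psi : dmor N M, deq (Dcomp psi phi) (Did M) /\ deq (Dcomp phi psi) (Did N).

Fixpoint dres (R S : cdgring) (f : cdghom R S) (M N : dgmod S) (phi : dmor M N) :
  dmor (res f M) (res f N) :=
  match phi in dmor M N return dmor (res f M) (res f N) with
  | Dmor M N g => Dmor (res_mor f g)
  | Dinv M N s hs => Dinv (hs : quasi_iso (res_mor f s))
  | Dcomp M N P phi psi => Dcomp (dres f phi) (dres f psi)
  end.

Definition RHom (R : cdgring) (M N : dgmod R) (J : kinj_resolution N) : dgmod R :=
  dgHom (cdgid R) M J.

Definition adjunction (R : cdgring) (M : dgmod R) (J : kinj_resolution M) :
  dmor (self_mod R) (RHom M J) := Dmor (adjunction_map (kinj_map J)).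

(** K-flat resolutions of a homomorphism [A -> B], written [A~ -> B~]. *)
Record kflat_ring_resolution (A B : cdgring) (f : cdghom A B) := KFlatRingResolution {
  rA : cdgring;
  rB : cdgring;
  rf : cdghom rA rB;
  rv : cdghom rA A;
  rw : cdghom rB B;
  rv_qi : quasi_iso rv;
  rw_qi : quasi_iso rw;
  rw_surj : forall i (b : B i), exists b' : rB i, rw i b' = b;
  r_square : forall i (a : rA i), rw i (rf i a) = f i (rv i a);
  r_kflat : kflat (res rf (self_mod rB))
}.

(** The commutative DG ring [B~ ⊗_A~ B~], with the homomorphism to [B] given by
    multiplication followed by [B~ -> B]. *)
Record enveloping (A B : cdgring) (f : cdghom A B) (K : kflat_ring_resolution f) :=
Enveloping {
  env :> tensor_ring (rf K);
  env_mul : cdghom env B;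
  env_mulE : forall i j k (e : i + j = k) (a : rB K i) (b : rB K j),
    env_mul k (a ⊗[tring_tens env, e] b) = mul e (rw K i a) (rw K j b)
}.

(** The choices entering the construction of [Sq(M)]: a K-flat resolution [M~] of
    [M] over [B~], and a K-injective resolution of [M~ ⊗_A~ M~].

    A K-projective resolution [s : P -> M~] is also recorded.  It serves to
    compute the action of [- ⊗^L -] on morphisms with source [M], a morphism
    [M~ -> N~] in D(B~) not being in general the class of a morphism of DG
    modules when [M~] is only K-flat.  That [s ⊗ s] is a quasi-isomorphism is
    automatic, [P] and [M~] being K-flat over [A~]. *)
Record sq_resolution (A B : cdgring) (f : cdghom A B) (K : kflat_ring_resolution f)
  (E : enveloping K) (M : dgmod B) := SqResolution {
  sq_flat : kflat_resolution (res (rw K) M);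
  sq_tens : tensor_sq E sq_flat;
  sq_inj : kinj_resolution sq_tens;
  sq_proj : kproj_resolution sq_flat;
  sq_proj_tens : tensor_sq E sq_proj;
  sq_proj_sq : dgmor sq_proj_tens sq_tens;
  sq_proj_sqE : is_tensor_sq_mor (kproj_map sq_proj) sq_proj_sq;
  sq_proj_sq_qi : quasi_iso sq_proj_sq
}.

Section Squaring.
Variables (A B : cdgring) (f : cdghom A B) (K : kflat_ring_resolution f)
  (E : enveloping K).

(** [Sq_{B/A}(M) = RHom_{B~ ⊗_A~ B~}(B, M ⊗^L_A~ M)]. *)
Definition Sq (M : dgmod B) (S : sq_resolution E M) : dgmod B :=
  dgHom (env_mul E) (self_mod B) (sq_inj S).

(** [chi = phi ⊗^L phi]: if [g : P -> N~] represents the morphism induced by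
    [phi], then [chi] is [(g ⊗ g) (s ⊗ s)^-1]. *)
Definition is_Ltensor_sq (M N : dgmod B) (S : sq_resolution E M) (S' : sq_resolution E N)
    (phi : dmor M N) (chi : dmor (sq_tens S) (sq_tens S')) : Prop :=
  exists (g : dgmor (sq_proj S) (sq_flat S')) (F : dgmor (sq_proj_tens S) (sq_tens S')),
    [/\ deq (Dcomp (Dmor (kflat_map (sq_flat S'))) (Dmor g))
            (Dcomp (dres (rw K) phi)
               (Dcomp (Dmor (kflat_map (sq_flat S))) (Dmor (kproj_map (sq_proj S))))),
        is_tensor_sq_mor g F &
        deq chi (Dcomp (Dmor F) (Dinv (sq_proj_sq_qi S)))].

(** [psi = RHom(id_B, chi)]: [chi] is represented by a morphism [g] between the
    K-injective resolutions, and [psi] is [Hom(id_B, g)]. *)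
Definition is_RHom_mor (M N : dgmod B) (S : sq_resolution E M) (S' : sq_resolution E N)
    (chi : dmor (sq_tens S) (sq_tens S')) (psi : dmor (Sq S) (Sq S')) : Prop :=
  exists g : dgmor (sq_inj S) (sq_inj S'),
    deq (Dcomp (Dmor g) (Dmor (kinj_map (sq_inj S))))
        (Dcomp (Dmor (kinj_map (sq_inj S'))) chi) /\
    deq psi (Dmor (hom_map (env_mul E) (self_mod B) g)).

Definition is_Sq_mor (M N : dgmod B) (S : sq_resolution E M) (S' : sq_resolution E N)
    (phi : dmor M N) (psi : dmor (Sq S) (Sq S')) : Prop :=
  exists chi, is_Ltensor_sq phi chi /\ is_RHom_mor chi psi.

Record rigid := Rigid {
  rig_mod :> dgmod B;
  rig_res : sq_resolution E rig_mod;
  rig_iso : dmor rig_mod (Sq rig_res);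
  rig_isoP : is_diso rig_iso
}.

Definition rigid_morphism (X Y : rigid) (phi : dmor X Y) : Prop :=
  exists psi : dmor (Sq (rig_res X)) (Sq (rig_res Y)),
    is_Sq_mor phi psi /\ deq (Dcomp (rig_iso Y) phi) (Dcomp psi (rig_iso X)).

Definition rigid_automorphism (X : rigid) (phi : dmor X X) : Prop :=
  rigid_morphism phi /\ is_diso phi.

End Squaring.

(* Main.v *)
(** Since [B -> RHom(M, M)] is an isomorphism, an endomorphism [phi] of [M] in
    [D(B)] is multiplication by a 0-cocycle [b] of [B]. As [M ⊗ M] is quadratic in
    [M], the functor [Sq] sends multiplication by [b] to multiplication by [b^2].
    Multiplication by [b] is natural on [D(B)], so if [phi] is rigid then
    [rho phi = phi^2 rho = rho phi^2], whence [phi = phi^2]; an idempotent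
    isomorphism is the identity.

    To compute [Sq phi], one must know that morphisms in the derived category out of
    a K-projective, or into a K-injective, DG module are homotopy classes of morphisms
    of DG modules, and that [g ⊗ g] and [Hom(B, g)] respect homotopy. *)

From Stdlib Require Import Setoid Morphisms.
From mathcomp Require Import all_boot all_algebra.
From mathcomp Require Import boolp.
From mathcomp Require Import zify.
Require Import Defs.
Set Implicit Arguments.
Unset Strict Implicit.
Unset Printing Implicit Defensive.
Import GRing.Theory.
Local Open Scope ring_scope.

(** Morphisms of D(B) are formal words and [deq] is a generated congruence, so an equation between
    words reveals nothing by itself. Consequences are extracted through three invariants: maps into
    a K-injective module up to homotopy, maps out of a K-projective module up to homotopy, and
    cohomology in degree 0. Each is encoded as a relation between representatives, so that a formal
    inverse is read as the converse relation and no quotient is formed. In the other direction,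
    homotopic maps become equal in D(B) because both ends of a cylinder do. The ring acting on M~ ⊗
    M~ is B~ ⊗ B~ rather than B. Hence b is first lifted, on the nose, to a cocycle b' of B~, which
    is possible because B~ -> B is a surjective quasi-isomorphism. The scalar b' ⊗ b' then acts on
    both tensor factors at once and lies over b^2. Since g ⊗ g is not additive in g, its
    compatibility with homotopy is not formal and rests on an explicit homotopy between tensor
    squares. *)

Lemma dgmor_eq (R : cdgring) (M N : dgmod R) (g h : dgmor M N) :
  (forall i x, g i x = h i x) -> g = h.
Proof.
case: g h => [g ga gd gl] [h ha hd hl] /= gh.
have E : g = h.
  apply: functional_extensionality_dep => i.
  by apply: functional_extensionality_dep => x; exact: gh.
by subst h; congr DGMor; exact: Prop_irrelevance.
Qed.

(** [homdif] hardwires the intermediate degrees [k - 1] and [j + 1]; here they are free, so that the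
    formula applies whatever form the degrees take in a goal. *)
Lemma hfun_dif (R S : cdgring) (f : cdghom R S) (X : dgmod S) (Y : dgmod R) i i'
    (ei : i + 1 = i') (h : homel f X Y i) j k l m (e : i' + j = k)
    (e1 : i + j = l) (e2 : l + 1 = k) (e3 : j + 1 = m) (e4 : i + m = k) x :
  hfun (homdif ei h) e x = dif e2 (hfun h e1 x) - hfun h e4 (dif e3 x) *~ ksign i.
Proof.
subst m; rewrite (eq_irrelevance e4 (homdif_e2 ei e)) /=.
by rewrite (dif_hfun_irr _ _ _ e1 e2).
Qed.

(** * Composition in Hom complexes *)

Section Composition.
Variables (R S : cdgring) (f : cdghom R S) (X : dgmod S).

Fact hcomp_subproof (i j k l m : int) :
  i + j = k -> k + l = m -> i + (j + l) = m.
Proof. by lia. Qed.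

Definition hcomp (Y Z : dgmod R) i j k (e : i + j = k) (g : homel (cdgid R) Y Z i)
  (h : homel f X Y j) : homel f X Z k.
Proof.
exists (fun l m e' x => hfun g (hcomp_subproof e e') (hfun h erefl x)).
- by move=> *; rewrite !hfun_add.
- move=> a l m al am e1 e2 e3 e4 r x.
  have e5 : a + (j + l) = j + al by lia.
  rewrite (hfun_act h e1 erefl erefl e5) hfun_sign.
  rewrite (hfun_act g e5 _ (hcomp_subproof e e3) e4) -mulrzA.
  by congr (_ *~ _); rewrite -e !signE; do 3!case: odd.
Defined.

Lemma hcompE (Y Z : dgmod R) i j k (e : i + j = k) (g : homel (cdgid R) Y Z i)
    (h : homel f X Y j) l m n (e' : k + l = m) (e1 : j + l = n) (e2 : i + n = m) x :
  hfun (hcomp e g h) e' x = hfun g e2 (hfun h e1 x).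
Proof. by subst n; rewrite (eq_irrelevance e2 (hcomp_subproof e e')). Qed.

Lemma hcompDl (Y Z : dgmod R) i j k (e : i + j = k) (g g' : homel (cdgid R) Y Z i)
    (h : homel f X Y j) :
  hcomp e (g + g') h = hcomp e g h + hcomp e g' h.
Proof. by apply: homel_eq. Qed.

Lemma hcompNl (Y Z : dgmod R) i j k (e : i + j = k) (g : homel (cdgid R) Y Z i)
    (h : homel f X Y j) :
  hcomp e (- g) h = - hcomp e g h.
Proof. by apply: homel_eq. Qed.

Lemma hcompDr (Y Z : dgmod R) i j k (e : i + j = k) (g : homel (cdgid R) Y Z i)
    (h h' : homel f X Y j) :
  hcomp e g (h + h') = hcomp e g h + hcomp e g h'.
Proof. by apply: homel_eq => l m el x /=; rewrite hfun_add. Qed.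

Lemma hcompNr (Y Z : dgmod R) i j k (e : i + j = k) (g : homel (cdgid R) Y Z i)
    (h : homel f X Y j) :
  hcomp e g (- h) = - hcomp e g h.
Proof. by apply: homel_eq => l m el x /=; rewrite hfunN. Qed.

Lemma hcomp0l (Y Z : dgmod R) i j k (e : i + j = k) (h : homel f X Y j) :
  hcomp e (0 : homel (cdgid R) Y Z i) h = 0.
Proof. by apply: homel_eq. Qed.

Lemma hcomp0r (Y Z : dgmod R) i j k (e : i + j = k) (g : homel (cdgid R) Y Z i) :
  hcomp e g (0 : homel f X Y j) = 0.
Proof. by apply: homel_eq => l m el x /=; rewrite hfun0. Qed.

(** Leibniz rule: the term that applies [h], then the differential of [Y], then [g] occurs twice on
    the right with opposite signs. Through this rule the later homotopies are verified without
    touching elements. *)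
Lemma homdif_hcomp (Y Z : dgmod R) i j k i' j' k' (e : i + j = k) (ei : i + 1 = i')
    (ej : j + 1 = j') (ek : k + 1 = k') (e1 : i' + j = k') (e2 : i + j' = k')
    (g : homel (cdgid R) Y Z i) (h : homel f X Y j) :
  homdif ek (hcomp e g h) =
  hcomp e1 (homdif ei g) h + hcomp e2 g (homdif ej h) *~ ksign i.
Proof.
apply: homel_eq => l m el x; rewrite hfunE_add hfunE_sign.
have a1 : k + l = m - 1 by lia.
have a2 : m - 1 + 1 = m by lia.
have a3 : k + (l + 1) = m by lia.
have a4 : i + (j + l) = m - 1 by lia.
have a5 : j + (l + 1) = j + l + 1 by lia.
have a6 : i + (j + l + 1) = m by lia.
have a7 : i' + (j + l) = m by lia.
have a8 : j' + l = j + l + 1 by lia.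
rewrite (hfun_dif _ _ _ a1 a2 erefl a3).
rewrite (hcompE _ _ _ a1 erefl a4) (hcompE _ _ _ a3 a5 a6).
rewrite (hcompE _ _ _ el erefl a7) (hfun_dif _ _ _ a4 a2 erefl a6).
rewrite (hcompE _ _ _ el a8 a6) (hfun_dif _ _ a8 erefl erefl erefl a5).
rewrite hfun_add hfunN hfun_sign mulrzDl mulNrz -mulrzA addrA.
rewrite addrNK; congr (_ - _ *~ _); rewrite -e !signE.
by do 2!case: odd.
Qed.

End Composition.

Lemma hcompA (R S : cdgring) (f : cdghom R S) (X : dgmod S) (Y Z W : dgmod R)
    i j k ij jk ijk (e1 : i + j = ij) (e2 : ij + k = ijk) (e3 : j + k = jk)
    (e4 : i + jk = ijk) (a : homel (cdgid R) Z W i) (b : homel (cdgid R) Y Z j)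
    (c : homel f X Y k) :
  hcomp e2 (hcomp e1 a b) c = hcomp e4 a (hcomp e3 b c).
Proof.
apply: homel_eq => l m el x.
have a1 : ij + (k + l) = m by lia.
have a2 : i + (j + (k + l)) = m by lia.
have a3 : jk + l = j + (k + l) by lia.
rewrite (hcompE _ _ _ el erefl a1) (hcompE _ _ _ a1 erefl a2).
by rewrite (hcompE _ _ _ el a3 a2) (hcompE _ _ _ a3 erefl erefl).
Qed.

(* Multiplying by the unit is how an element is transported between equal degrees. *)
Definition hom_of (R : cdgring) (M N : dgmod R) (g : dgmor M N) :
  homel (cdgid R) M N 0 := adjunction_el g (one R).

Lemma hom_ofE (R : cdgring) (M N : dgmod R) (g : dgmor M N) i (e : 0 + i = i) x :
  hfun (hom_of g) e x = g i x.
Proof. by rewrite /= act_1. Qed.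

Lemma homel0_eq (R S : cdgring) (f : cdghom R S) (X : dgmod S) (Y : dgmod R)
    (g h : homel f X Y 0) :
  (forall i (e : 0 + i = i) x, hfun g e x = hfun h e x) -> g = h.
Proof.
move=> gh; apply: homel_eq => j k e x.
have ek : j = k by rewrite -e add0r.
by case: k / ek e => e; exact: gh.
Qed.

Lemma dif_one (R : cdgring) j (e : 0 + 1 = j) : dif e (one R) = 0.
Proof. by apply: ring_nonpos; rewrite -e. Qed.

(** [hom_of g] is the image of the cocycle [one R] under the chain map [adjunction_map g]. *)
Lemma homdif_hom_of (R : cdgring) (M N : dgmod R) (g : dgmor M N) i (e : 0 + 1 = i) :
  homdif e (hom_of g) = 0.
Proof.
rewrite -[hom_of g]/(adjunction_map g 0 (one R)).
rewrite -[homdif _ _]/(dif (c := dgHom (cdgid R) M N) e _).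
by rewrite -(mfun_dif (adjunction_map g)) dif_one mfun0.
Qed.

Lemma hom_of_comp (R : cdgring) (M N P : dgmod R) (g : dgmor N P) (h : dgmor M N)
    (e : 0 + 0 = 0) :
  hom_of (dgcomp g h) = hcomp e (hom_of g) (hom_of h).
Proof.
apply: homel0_eq => i ei x.
by rewrite (hcompE _ _ _ ei ei ei) !hom_ofE.
Qed.

Lemma hcomp1l (R S : cdgring) (f : cdghom R S) (X : dgmod S) (Y : dgmod R) i
    (e : 0 + i = i) (h : homel f X Y i) :
  hcomp e (hom_of (dgid Y)) h = h.
Proof.
apply: homel_eq => l m el x.
by rewrite (hcompE _ _ _ el el (add0r m)) hom_ofE.
Qed.

Lemma hcomp1r (R : cdgring) (X Y : dgmod R) i (e : i + 0 = i)
    (h : homel (cdgid R) X Y i) :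
  hcomp e h (hom_of (dgid X)) = h.
Proof.
apply: homel_eq => l m el x.
by rewrite (hcompE _ _ _ el (add0r l) el) hom_ofE.
Qed.

(** Inverse to [hom_of]: a 0-cocycle of the Hom complex is the same thing as a morphism of DG
    modules. *)
Definition of_hom (R : cdgring) (M N : dgmod R) (h : homel (cdgid R) M N 0)
  (dh : homdif (add0r 1) h = 0) : dgmor M N.
Proof.
exists (fun i x => hfun h (add0r i) x).
- by move=> *; rewrite hfun_add.
- move=> i j e x; apply/esym/eqP; rewrite -subr_eq0.
  have e' : 1 + i = j by lia.
  have := hfun_dif (add0r 1) h e' (add0r i) e e (add0r j) x.
  by rewrite dh mulr1z => <-.
- move=> i j k e a x.
  by rewrite (hfun_act h e (add0r k) (add0r j) e) mul0r.
Defined.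

Lemma of_homK (R : cdgring) (M N : dgmod R) (h : homel (cdgid R) M N 0)
    (dh : homdif (add0r 1) h = 0) :
  hom_of (of_hom dh) = h.
Proof.
apply: homel0_eq => i e x; rewrite hom_ofE /=.
by rewrite (eq_irrelevance e (add0r i)).
Qed.

Lemma homdif_zero (R S : cdgring) (f : cdghom R S) (X : dgmod S) (Y : dgmod R) i j
    (e : i + 1 = j) :
  homdif e (0 : homel f X Y i) = 0.
Proof. exact: (@dif0 (hom_cplx f X Y)). Qed.

Lemma homdif_opp (R S : cdgring) (f : cdghom R S) (X : dgmod S) (Y : dgmod R) i j
    (e : i + 1 = j) (h : homel f X Y i) :
  homdif e (- h) = - homdif e h.
Proof. exact: (@difN (hom_cplx f X Y)). Qed.

(** [boundary] hides the degree of the primitive, which is only provably equal to the expected one;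
    the primitive is transported to a degree chosen in advance. *)
Lemma acyclic_primitive (R S : cdgring) (f : cdghom R S) (X : dgmod S) (Y : dgmod R) :
  acyclic (dgHom f X Y) ->
  forall i j k (e : i + 1 = j) (e' : j + 1 = k) (h : homel f X Y j),
    homdif e' h = 0 -> exists g : homel f X Y i, homdif e g = h.
Proof.
move=> acy i j k e e' h dh.
have ch : cocycle (h : dgHom f X Y j).
  move=> k' e''; have ek : k = k' by rewrite -e' -e''.
  by case: k' / ek e'' => e''; rewrite (eq_irrelevance e'' e').
have [i' [ei [g dg]]] := acy _ _ ch.
have ii : i' = i by lia.
by case: i / ii e => e; exists g; rewrite (eq_irrelevance e ei).
Qed.

(** * Homotopy *)

Definition homotopic (R : cdgring) (M N : dgmod R) (g g' : dgmor M N) : Prop :=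
  exists h : homel (cdgid R) M N (-1), homdif (addNr 1) h = hom_of g - hom_of g'.

Lemma homotopic_refl (R : cdgring) (M N : dgmod R) (g : dgmor M N) : homotopic g g.
Proof. by exists 0; rewrite subrr homdif_zero. Qed.

Lemma homotopic_sym (R : cdgring) (M N : dgmod R) (g g' : dgmor M N) :
  homotopic g g' -> homotopic g' g.
Proof. by case=> h dh; exists (- h); rewrite homdif_opp dh opprB. Qed.

Lemma homotopic_trans (R : cdgring) (M N : dgmod R) (g g' g'' : dgmor M N) :
  homotopic g g' -> homotopic g' g'' -> homotopic g g''.
Proof.
by case=> h dh [h' dh']; exists (h + h'); rewrite homdif_add dh dh' addrA addrNK.
Qed.

Lemma homotopic_compl (R : cdgring) (M N P : dgmod R) (k : dgmor N P) (g g' : dgmor M N) :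
  homotopic g g' -> homotopic (dgcomp k g) (dgcomp k g').
Proof.
case=> h dh; exists (hcomp (add0r _) (hom_of k) h).
rewrite (homdif_hcomp _ (add0r 1) (addNr 1) _ (addrN 1) (add0r 0)).
by rewrite homdif_hom_of hcomp0l add0r mulr1z dh hcompDr hcompNr -!hom_of_comp.
Qed.

Lemma homotopic_compr (R : cdgring) (M N P : dgmod R) (k : dgmor M N) (g g' : dgmor N P) :
  homotopic g g' -> homotopic (dgcomp g k) (dgcomp g' k).
Proof.
case=> h dh; exists (hcomp (addr0 _) h (hom_of k)).
rewrite (homdif_hcomp _ (addNr 1) (add0r 1) _ (add0r 0) (addNr 1)).
by rewrite homdif_hom_of hcomp0r mul0rz addr0 dh hcompDl hcompNl -!hom_of_comp.
Qed.

Lemma dif_hom_of (R : cdgring) (M N : dgmod R) (g : dgmor M N) i j k l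
    (e1 : 0 + i = j) (e2 : j + 1 = k) (e3 : i + 1 = l) (e4 : 0 + l = k) (x : M i) :
  dif e2 (hfun (hom_of g) e1 x) = hfun (hom_of g) e4 (dif e3 x).
Proof.
have e : 1 + i = k by lia.
have := hfun_dif (add0r 1) (hom_of g) e e1 e2 e3 e4 x.
by rewrite homdif_hom_of mulr1z => /esym/eqP; rewrite subr_eq0 => /eqP.
Qed.

Lemma pair_sign (U V : zmodType) (z : U * V) n :
  z *~ ksign n = (z.1 *~ ksign n, z.2 *~ ksign n).
Proof. by case: z => u v; rewrite ksignE; case: odd; rewrite ?mulrN1z ?mulr1z. Qed.

(** * Cones *)

Section Cone.
Variables (R : cdgring) (M N : dgmod R) (s : dgmor M N).

Fact cone_e (i j : int) : i + 1 = j -> 0 + (i + 1) = j. Proof. by lia. Qed.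
Fact cone_e1 (i j : int) : i + 1 = j -> i + 1 + 1 = j + 1. Proof. by lia. Qed.
Fact cone_e2 (i j k : int) : i + j = k -> i + (j + 1) = k + 1. Proof. by lia. Qed.

Definition cone_gr (i : int) : zmodType := (N i * M (i + 1)%R)%type.

(** [hom_of s] replaces [s] because the second component has degree [i + 1], while its image must
    land in the degree written [j]. *)
Definition cone_dif i j (e : i + 1 = j) (z : cone_gr i) : cone_gr j :=
  (dif e z.1 + hfun (hom_of s) (cone_e e) z.2, - dif (cone_e1 e) z.2).

Definition cone_cplx : cplx.
Proof.
exists cone_gr cone_dif.
- move=> i j e [y x] [y' x']; rewrite /cone_dif /= !(dif_add, act_addr, mfun_add) opprD.
  by congr (_, _); rewrite addrACA.
- move=> i j k e e' [y x]; rewrite /cone_dif.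
  rewrite dif_add dif_dif add0r (dif_hom_of _ _ _ (cone_e1 e) (cone_e e')).
  by rewrite hfunN addrN difN dif_dif !oppr0.
Defined.

(** The sign on the second component is that of the shift M[1]: a scalar of degree [i] passes a
    shift of degree 1. With it the negated differential satisfies the Leibniz rule. *)
Definition cone : dgmod R.
Proof.
exists cone_cplx (fun i j k e a (z : cone_gr j) =>
  ((act e a z.1, act (cone_e2 e) a z.2 *~ ksign i) : cone_gr k)).
- by move=> i j k e a b [y x] /=; rewrite !act_addl mulrzDl.
- by move=> i j k e a [y x] [y' x'] /=; rewrite !act_addr mulrzDl.
- move=> i j k ij jk ijk e1 e2 e3 e4 a b [y x] /=.
  rewrite (act_assoc _ _ e3 e4) (act_assoc _ _ (cone_e2 e3) (cone_e2 e4)).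
  congr (_, _); rewrite act_sign -!mulrzA; congr (_ *~ _); rewrite -e1 !signE.
  by do 2!case: odd.
- move=> i e [y x] /=; rewrite act_1 mulr1z.
  by rewrite (eq_irrelevance (cone_e2 e) (add0r _)) act_1.
- move=> i j k i' j' k' e ei ej ek e1 e2 a [y x].
  rewrite pair_sign /= /cone_dif.
  congr (_, _).
  + rewrite (dif_act e ei ej ek e1 e2) act_addr mulrzDl addrA hfun_sign.
    congr (_ + _ *~ _).
    have e3 : 0 + (k + 1) = k' by lia.
    have e4 : i + (j + 1) = k' by lia.
    rewrite (hfun_act _ _ _ (cone_e ej) e2) mul0r //.
  + rewrite dif_sign (dif_act _ ei (cone_e1 ej) _ (cone_e2 e1) (cone_e2 e2)).
    rewrite actNr -!mulrzA mulrzDl opprD -mulrzA !mulNrz /=; congr (_ - _).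
    move: (act (cone_e2 e1) _ _) => p; rewrite -ei -mulrNz !signE.
    by case: odd.
Defined.

End Cone.

Lemma homel1_eq (R S : cdgring) (f : cdghom R S) (X : dgmod S) (Y : dgmod R)
    (g h : homel f X Y 1) :
  (forall i (e : 1 + i = i + 1) x, hfun g e x = hfun h e x) -> g = h.
Proof.
move=> gh; apply: homel_eq => j k e x.
have ek : j + 1 = k by lia.
by case: k / ek e => e; exact: gh.
Qed.

(* As a graded module the cone is the direct sum of [N] and of the shift of [M]; the
   differentials of its injections and projections, taken as elements of Hom
   complexes, say all that is needed to lift maps along [s]. *)

Section ConeMaps.
Variables (R : cdgring) (M N : dgmod R) (s : dgmor M N).
Local Notation C := (cone s).

Fact cone_projM_subproof (j k : int) : 1 + j = k -> 0 + (j + 1) = k.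
Proof. by lia. Qed.
Fact cone_inM_subproof (j k : int) : -1 + j = k -> 0 + j = k + 1.
Proof. by lia. Qed.

Definition cone_projN : homel (cdgid R) C N 0.
Proof.
exists (fun j k e (z : C j) => hfun (hom_of (dgid N)) e z.1).
- by move=> j k e x y; rewrite hfun_add.
- move=> a j k aj ak e1 e2 e3 e4 r x.
  by rewrite -(hfun_act (hom_of (dgid N)) e1 e2).
Defined.

Definition cone_projM : homel (cdgid R) C M 1.
Proof.
exists (fun j k e (z : C j) => hfun (hom_of (dgid M)) (cone_projM_subproof e) z.2).
- by move=> j k e x y; rewrite hfun_add.
- move=> a j k aj ak e1 e2 e3 e4 r x; rewrite hfun_sign.
  have := hfun_act (hom_of (dgid M)) (cone_e2 e1) (cone_projM_subproof e2)
    (cone_projM_subproof e3) e4 r x.2.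
  by rewrite mul0r mulr1z mul1r => <-.
Defined.

Definition cone_inN : dgmor N C.
Proof.
exists (fun i (y : N i) => (y, 0) : C i).
- by move=> i x y; congr (_, _); rewrite addr0.
- by move=> i j e x; congr (_, _); rewrite ?hfun0 ?addr0 ?dif0 ?oppr0.
- by move=> i j k e a x; congr (_, _); rewrite act0r mul0rz.
Defined.

Definition cone_inM : homel (cdgid R) M C (-1).
Proof.
exists (fun j k e (x : M j) =>
  (0, hfun (hom_of (dgid M)) (cone_inM_subproof e) x) : C k).
- by move=> j k e x y; congr (_, _); rewrite ?hfun_add ?addr0.
- move=> a j k aj ak e1 e2 e3 e4 r x; rewrite pair_sign; congr (_, _).
    by rewrite /= act0r mul0rz.
  rewrite (hfun_act (hom_of (dgid M)) e1 (cone_inM_subproof e2) (cone_inM_subproof e3)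
    (cone_e2 e4)) /= -mulrzA mul0r mulr1z mulN1r.
  by rewrite /ksign abszN -expr2 sqrr_sign mulr1z.
Defined.

Lemma cone_projN_inN (e : 0 + 0 = 0) :
  hcomp e cone_projN (hom_of cone_inN) = hom_of (dgid N).
Proof.
by apply: homel0_eq => i ei x; rewrite (hcompE _ _ _ ei ei ei) !hom_ofE /= act_1.
Qed.

Lemma cone_projM_inN (e : 1 + 0 = 1) :
  hcomp e cone_projM (hom_of cone_inN) = 0.
Proof.
apply: homel1_eq => i ei x.
by rewrite (hcompE _ _ _ ei (add0r i) ei) hom_ofE /= act0r.
Qed.

Lemma cone_projM_inM (e : 1 + -1 = 0) :
  hcomp e cone_projM cone_inM = hom_of (dgid M).
Proof.
apply: homel0_eq => i ei x.
have e1 : -1 + i = i - 1 by lia.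
have e2 : 1 + (i - 1) = i by lia.
rewrite (hcompE _ _ _ ei e1 e2) /= -(act_assoc (add0r 0)).
by rewrite mul_1l.
Qed.

Lemma homdif_cone_projM (e : 1 + 1 = 2) : homdif e cone_projM = 0.
Proof.
apply: homel_eq => j k ek z.
have e1 : 1 + j = k - 1 by lia.
have e2 : 1 + (j + 1) = k by lia.
rewrite (hfun_dif _ _ _ e1 (subrK 1 k) erefl e2) /=.
have e3 : j + 1 + 1 = k by lia.
have := dif_hom_of (dgid M) (cone_projM_subproof e1) (subrK 1 k)
  (cone_e1 erefl) (cone_projM_subproof e2) z.2.
by rewrite /= => ->; rewrite actNr mulrN1z opprK addrN.
Qed.

Lemma homdif_cone_projN (e : 0 + 1 = 1) (e' : 0 + 1 = 1) :
  homdif e cone_projN = - hcomp e' (hom_of s) cone_projM.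
Proof.
apply: homel1_eq => j ek z; rewrite hfunE_opp.
have e2 : 0 + (j + 1) = j + 1 by lia.
rewrite (hfun_dif _ _ _ (add0r j) erefl erefl e2).
rewrite (hcompE _ _ _ ek ek e2) hom_ofE.
by rewrite /= !act_1 mulr1z opprD addrA addrN add0r.
Qed.

(** So [cone_inM] is the canonical null-homotopy of the composite M -> N -> cone. *)
Lemma homdif_cone_inM (e : -1 + 1 = 0) (e' : 0 + 0 = 0) :
  homdif e cone_inM = hcomp e' (hom_of cone_inN) (hom_of s).
Proof.
apply: homel0_eq => j ej x.
have e1 : -1 + j = j - 1 by lia.
have e2 : -1 + (j + 1) = j by lia.
rewrite (hfun_dif _ _ _ e1 (subrK 1 j) erefl e2).
rewrite (hcompE _ _ _ ej ej ej) !hom_ofE mulrN1z opprK /= /cone_dif /=.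
congr (_, _).
  by rewrite dif0 add0r addr0 -(act_assoc (add0r 0) ej) mul_1l act_1.
have e3 : 0 + (j + 1) = j + 1 by lia.
rewrite (eq_irrelevance (cone_inM_subproof e2) e3) act_1.
have := dif_hom_of (dgid M) (cone_inM_subproof e1) (cone_e1 (subrK 1 j)) erefl e3 x.
by rewrite /= act_1 => ->; rewrite addNr.
Qed.

(** For a cocycle (y, x), the element s x bounds -y, so x = d x' by injectivity on cohomology. Then
    y + s x' is a cocycle, equal to s x'' + d y' by surjectivity, and (y', x'' - x') is a
    primitive. *)
Lemma cone_acyclic : quasi_iso s -> acyclic C.
Proof.
(* The primitive lives one degree lower; after the renaming this lower degree is the variable
   [i]. *)
case=> sinj ssurj i; have -> : i = i - 1 + 1 by rewrite subrK.
move: (i - 1) => {}i [y x] cz.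
have [dy dx] : dif erefl y + hfun (hom_of s) (cone_e erefl) x = 0 /\ dif erefl x = 0.
  have := cz _ erefl; rewrite /= /cone_dif /= => -[-> /eqP].
  by rewrite oppr_eq0 => /eqP; rewrite (eq_irrelevance (cone_e1 _) erefl).
rewrite (eq_irrelevance (cone_e _) (add0r (i + 1 + 1))) hom_ofE in dy.
have cx : cocycle x.
  by move=> j e; subst j.
have bx : boundary (s _ x).
  exists (i + 1), erefl, (- y); rewrite difN.
  by apply: (addrI (dif erefl y)); rewrite addrN dy.
have [j [ej [x' dx']]] := sinj _ _ cx bx.
have ij : i + 1 = j by lia.
case: j / ij ej x' dx' => ej x' dx'.
have cyx : cocycle (y + s _ x').
  move=> j e; subst j; rewrite dif_add -mfun_dif -(eq_irrelevance ej erefl) dx'.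
  rewrite (eq_irrelevance ej erefl).
  exact: dy.
have [x'' [cx'' [j [e [y' dy']]]]] := ssurj _ _ cyx.
have ij : i = j by lia.
case: j / ij e y' dy' => e y' dy'.
exists i, e, (y', x'' - x'); rewrite /= /cone_dif /=.
rewrite (eq_irrelevance (cone_e e) (add0r _)) (eq_irrelevance (cone_e1 e) ej).
rewrite act_1 dy' dif_add cx'' add0r difN dx' opprK mfun_add mfunN.
by rewrite addrA addrNK addrK.
Qed.

End ConeMaps.

(** * Lifting along quasi-isomorphisms, for K-injective and K-projective modules *)

Lemma kinj_lift (R : cdgring) (M N I : dgmod R) (s : dgmor M N) (a : dgmor M I) :
  kinj I -> quasi_iso s -> exists b : dgmor N I, homotopic a (dgcomp b s).
Proof.
move=> kI qs; have acy := kI _ (cone_acyclic qs).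
(* The composite cone -> M -> I is a cocycle of an acyclic complex. A primitive [k] of it restricts
   on N to the negative of the extension sought, and on M to the homotopy. *)
pose t := hcomp (add0r 1) (hom_of a) (cone_projM s).
have dt : homdif (erefl : 1 + 1 = 2) t = 0.
  rewrite (homdif_hcomp _ (add0r 1) (erefl : 1 + 1 = 2) _ erefl (add0r 2)).
  by rewrite homdif_hom_of homdif_cone_projM hcomp0l hcomp0r add0r mul0rz.
have [k dk] := acyclic_primitive acy (add0r 1) dt.
pose u := hcomp (addr0 0) k (hom_of (cone_inN s)).
have du : homdif (add0r 1) u = 0.
  rewrite (homdif_hcomp _ (add0r 1) (add0r 1) _ (addr0 1) (add0r 1)).
  rewrite homdif_hom_of hcomp0r mul0rz addr0 dk.
  by rewrite (hcompA _ _ (addr0 1) (add0r 1)) cone_projM_inN hcomp0r.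
have du' : homdif (add0r 1) (- u) = 0 by rewrite homdif_opp du oppr0.
exists (of_hom du'), (hcomp (add0r (-1)) k (cone_inM s)).
rewrite (homdif_hcomp _ (add0r 1) (addNr 1) _ (addrN 1) (addr0 0)) mulr1z dk.
rewrite (hcompA _ _ (addrN 1) (add0r 0)) cone_projM_inM hcomp1r.
rewrite (homdif_cone_inM s _ (addr0 0)) -(hcompA (addr0 0) (addr0 0)).
by rewrite (hom_of_comp _ _ (addr0 0)) of_homK hcompNl opprK.
Qed.

Lemma kinj_inj (R : cdgring) (M N I : dgmod R) (s : dgmor M N) (b b' : dgmor N I) :
  kinj I -> quasi_iso s -> homotopic (dgcomp b s) (dgcomp b' s) -> homotopic b b'.
Proof.
move=> kI qs [h dh]; have acy := kI _ (cone_acyclic qs).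
pose c := hom_of b - hom_of b'.
have dc : homdif (add0r 1) c = 0.
  by rewrite homdif_add homdif_opp !homdif_hom_of subr0.
(* The difference [c] on N and the homotopy [h] on M glue to a cocycle on the cone. The restriction
   to N of a primitive is then a homotopy from [b] to [b']. *)
pose k := hcomp (addr0 0) c (cone_projN s) + hcomp (addNr 1) h (cone_projM s).
have dk : homdif (add0r 1) k = 0.
  rewrite homdif_add (homdif_hcomp _ (add0r 1) (add0r 1) _ (addr0 1) (add0r 1)).
  rewrite (homdif_hcomp _ (addNr 1) (erefl : 1 + 1 = 2) _ (add0r 1) (addKr 1 1)).
  rewrite dc hcomp0l add0r mulr1z homdif_cone_projM hcomp0r mul0rz addr0 dh.
  rewrite (homdif_cone_projN s _ (add0r 1)) hcompNr -(hcompA (addr0 0) (add0r 1)).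
  by rewrite !(hom_of_comp _ _ (addr0 0)) hcompDl hcompNl addNr.
have [l dl] := acyclic_primitive acy (addNr 1) dk.
exists (hcomp (addr0 (-1)) l (hom_of (cone_inN s))).
rewrite (homdif_hcomp _ (addNr 1) (add0r 1) _ (addr0 0) (addNr 1)).
rewrite homdif_hom_of hcomp0r mul0rz addr0 dl /k hcompDl.
rewrite !(hcompA _ _ (addr0 0) (addr0 0)) cone_projN_inN hcomp1r.
by rewrite (hcompA _ _ (addr0 1) (addNr 1)) cone_projM_inN hcomp0r addr0.
Qed.

Lemma kproj_lift (R : cdgring) (P M N : dgmod R) (s : dgmor M N) (a : dgmor P N) :
  kproj P -> quasi_iso s -> exists b : dgmor P M, homotopic a (dgcomp s b).
Proof.
move=> kP qs; have acy := kP _ (cone_acyclic qs).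
(* Dual to the K-injective case: the M-component of a primitive [k] of [t] is the lift, and its
   N-component is the homotopy. *)
pose t := hcomp (addr0 0) (hom_of (cone_inN s)) (hom_of a).
have dt : homdif (add0r 1) t = 0.
  rewrite (homdif_hcomp _ (add0r 1) (add0r 1) _ (addr0 1) (add0r 1)).
  by rewrite !homdif_hom_of hcomp0l hcomp0r mul0rz addr0.
have [k dk] := acyclic_primitive acy (addNr 1) dt.
pose u := hcomp (addrN 1) (cone_projM s) k.
have du : homdif (add0r 1) u = 0.
  rewrite (homdif_hcomp _ (erefl : 1 + 1 = 2) (addNr 1) _ (addrK 1 1) (addr0 1)).
  rewrite homdif_cone_projM hcomp0l add0r dk.
  by rewrite -(hcompA (addr0 1) (addr0 1)) cone_projM_inN hcomp0l mul0rz.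
exists (of_hom du), (hcomp (add0r (-1)) (cone_projN s) k).
rewrite (homdif_hcomp _ (add0r 1) (addNr 1) _ (addrN 1) (addr0 0)) mulr1z dk.
rewrite -(hcompA (addr0 0) (addr0 0)) cone_projN_inN hcomp1l.
rewrite (homdif_cone_projN s _ (add0r 1)) hcompNl (hcompA _ _ (addrN 1) (addr0 0)).
by rewrite (hom_of_comp _ _ (addr0 0)) of_homK addrC.
Qed.

Lemma kproj_inj (R : cdgring) (P M N : dgmod R) (s : dgmor M N) (b b' : dgmor P M) :
  kproj P -> quasi_iso s -> homotopic (dgcomp s b) (dgcomp s b') -> homotopic b b'.
Proof.
move=> kP qs [h dh]; have acy := kP _ (cone_acyclic qs).
pose c := hom_of b - hom_of b'.
have dc : homdif (add0r 1) c = 0.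
  by rewrite homdif_add homdif_opp !homdif_hom_of subr0.
pose k := hcomp (addr0 (-1)) (cone_inM s) c - hcomp (add0r (-1)) (hom_of (cone_inN s)) h.
have dk : homdif (addNr 1) k = 0.
  rewrite homdif_add homdif_opp.
  rewrite (homdif_hcomp _ (addNr 1) (add0r 1) _ (addr0 0) (addNr 1)).
  rewrite (homdif_hcomp _ (add0r 1) (addNr 1) _ (addrN 1) (addr0 0)).
  rewrite dc hcomp0r mul0rz addr0 homdif_hom_of hcomp0l add0r mulr1z dh.
  rewrite (homdif_cone_inM s _ (addr0 0)) (hcompA _ _ (addr0 0) (addr0 0)).
  by rewrite !(hom_of_comp _ _ (addr0 0)) /c [hcomp _ _ (hom_of b - _)]hcompDr hcompNr subrr.
have [l dl] := acyclic_primitive acy (erefl : -2 + 1 = -1 :> int) dk.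
(* The sign offsets the one that the Leibniz rule produces when the differential passes
   [cone_projM], of degree 1. *)
exists (- hcomp (erefl : 1 + -2 = -1 :> int) (cone_projM s) l).
rewrite homdif_opp.
rewrite (homdif_hcomp _ (erefl : 1 + 1 = 2) (erefl : -2 + 1 = -1 :> int) _ erefl (addrN 1)).
rewrite homdif_cone_projM hcomp0l add0r dl mulrN1z opprK hcompDr hcompNr.
rewrite -(hcompA (addrN 1) (add0r 0)) cone_projM_inM hcomp1l.
by rewrite -(hcompA (addr0 1) (addrN 1)) cone_projM_inN hcomp0l subr0.
Qed.

(** * Direct sums and cylinders *)

Lemma quasi_iso_id (R : cdgring) (M : dgmod R) : quasi_iso (dgid M).
Proof.
split=> [i x //|i y cy]; exists y; split=> //.
exists (i - 1), (subrK 1 i), 0; by rewrite dif0 subrr.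
Qed.

Section DirectSum.
Variables (R : cdgring) (M N : dgmod R).

Definition dsum_cplx : cplx.
Proof.
exists (fun i => (M i * N i)%type : zmodType)
  (fun i j e (z : M i * N i) => (dif e z.1, dif e z.2)).
- by move=> i j e [x y] [x' y']; congr (_, _); rewrite dif_add.
- by move=> i j k e e' [x y]; congr (_, _); rewrite dif_dif.
Defined.

Definition dsum : dgmod R.
Proof.
exists dsum_cplx (fun i j k e a z => (act e a z.1, act e a z.2)).
- by move=> i j k e a b [x y]; congr (_, _); rewrite act_addl.
- by move=> i j k e a [x y] [x' y']; congr (_, _); rewrite act_addr.
- by move=> i j k ij jk ijk e1 e2 e3 e4 a b [x y] /=; rewrite !(act_assoc _ _ e3 e4).
- by move=> i e [x y] /=; rewrite !act_1.
- move=> i j k i' j' k' e ei ej ek e1 e2 a [x y]; rewrite pair_sign /=.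
  by rewrite !(dif_act e ei ej ek e1 e2).
Defined.

Definition dsum_in1 : dgmor M dsum.
Proof.
exists (fun i (x : M i) => (x, 0) : dsum i).
- by move=> i x y; congr (_, _); rewrite addr0.
- by move=> i j e x; congr (_, _); rewrite dif0.
- by move=> i j k e a x; congr (_, _); rewrite act0r.
Defined.

Definition dsum_in2 : dgmor N dsum.
Proof.
exists (fun i (x : N i) => (0, x) : dsum i).
- by move=> i x y; congr (_, _); rewrite addr0.
- by move=> i j e x; congr (_, _); rewrite dif0.
- by move=> i j k e a x; congr (_, _); rewrite act0r.
Defined.

Definition dsum_copair (P : dgmod R) (g : dgmor M P) (h : dgmor N P) : dgmor dsum P.
Proof.
exists (fun i (z : dsum i) => g i z.1 + h i z.2).
- by move=> i x y; rewrite !mfun_add addrACA.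
- by move=> i j e x; rewrite !mfun_dif dif_add.
- by move=> i j k e a x; rewrite !mfun_act act_addr.
Defined.

End DirectSum.

Definition antidiagonal (R : cdgring) (M : dgmod R) : dgmor M (dsum M M).
Proof.
exists (fun i (x : M i) => (x, - x) : dsum M M i).
- by move=> i x y; congr (_, _); rewrite opprD.
- by move=> i j e x; congr (_, _); rewrite difN.
- by move=> i j k e a x; congr (_, _); rewrite actNr.
Defined.

(** A morphism out of the cone of x |-> (x, -x) amounts to two morphisms out of M together with a
    null-homotopy of their difference. *)
Definition cylinder (R : cdgring) (M : dgmod R) : dgmod R := cone (antidiagonal M).

Definition cylinder_in1 (R : cdgring) (M : dgmod R) : dgmor M (cylinder M) :=
  dgcomp (cone_inN _) (dsum_in1 M M).

Definition cylinder_in2 (R : cdgring) (M : dgmod R) : dgmor M (cylinder M) :=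
  dgcomp (cone_inN _) (dsum_in2 M M).

Definition cylinder_proj (R : cdgring) (M : dgmod R) : dgmor (cylinder M) M.
Proof.
exists (fun i (z : cylinder M i) => z.1.1 + z.1.2).
- by move=> i x y; rewrite addrACA.
- move=> i j e z; rewrite /= /cone_dif /= addrACA subrr addr0.
  by rewrite dif_add.
- by move=> i j k e a z; rewrite /= act_addr.
Defined.

Lemma cylinder_proj_qi (R : cdgring) (M : dgmod R) : quasi_iso (cylinder_proj M).
Proof.
split=> [i [[y1 y2] x] cz [j [e [w dw]]]|i y cy].
  (* With y1 + y2 = d w, the differential of ((0, w), y1) is ((y1, d w - y1), - d y1). This is ((y1,
     y2), x), the cocycle condition giving x = - d y1. *)
  subst i; exists j, erefl, ((0, w), y1 : M (j + 1)).
  have := cz _ erefl; rewrite /= /cone_dif /= => -[dy1 dy2 _].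
  rewrite /= in dw.
  rewrite (eq_irrelevance (cone_e _) (add0r (j + 1))) act_1.
  rewrite -[LHS]/((dif erefl 0 + y1, dif erefl w - y1), - dif (cone_e1 erefl) y1).
  rewrite dif0 add0r dw [y1 + y2]addrC addrK; congr (_, _).
  rewrite (eq_irrelevance (cone_e _) (add0r (j + 1 + 1))) act_1 in dy1.
  rewrite (eq_irrelevance (cone_e1 _) erefl).
  by apply: (addrI (dif erefl y1)); rewrite addrN dy1.
exists ((y, 0), 0); split.
  by move=> j e; rewrite /= /cone_dif /= cy dif0 act0r !oppr0 !addr0 dif0 oppr0.
by exists (i - 1), (subrK 1 i), 0; rewrite dif0 /= addr0 subrr.
Qed.

Lemma homotopic_cylinder (R : cdgring) (M N : dgmod R) (g g' : dgmor M N) :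
  homotopic g g' -> exists c : dgmor (cylinder M) N,
    g = dgcomp c (cylinder_in1 M) /\ g' = dgcomp c (cylinder_in2 M).
Proof.
case=> h dh; set s := antidiagonal M; pose b := dsum_copair g g'.
pose k := hcomp (addr0 0) (hom_of b) (cone_projN s) + hcomp (addNr 1) h (cone_projM s).
have bs : hcomp (addr0 0) (hom_of b) (hom_of s) = hom_of g - hom_of g'.
  rewrite -hom_of_comp; apply: homel0_eq => i e x.
  by rewrite hfunE_add hfunE_opp !hom_ofE /= mfunN.
have dk : homdif (add0r 1) k = 0.
  rewrite homdif_add (homdif_hcomp _ (add0r 1) (add0r 1) _ (addr0 1) (add0r 1)).
  rewrite (homdif_hcomp _ (addNr 1) (erefl : 1 + 1 = 2) _ (add0r 1) (addKr 1 1)).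
  rewrite homdif_hom_of hcomp0l add0r mulr1z homdif_cone_projM hcomp0r mul0rz addr0 dh.
  rewrite (homdif_cone_projN s _ (add0r 1)) hcompNr -(hcompA (addr0 0) (add0r 1)).
  by rewrite bs addNr.
have kin : hcomp (addr0 0) k (hom_of (cone_inN s)) = hom_of b.
  rewrite hcompDl (hcompA _ _ (addr0 0) (addr0 0)) cone_projN_inN hcomp1r.
  by rewrite (hcompA _ _ (addr0 1) (addNr 1)) cone_projM_inN hcomp0r addr0.
have cb : forall i y, of_hom dk i (cone_inN s i y) = b i y.
  move=> i y; rewrite -(hom_ofE (of_hom dk) (add0r i)) -(hom_ofE (cone_inN s) (add0r i)).
  by rewrite of_homK -(hcompE (addr0 0) _ _ (add0r i)) kin hom_ofE.
exists (of_hom dk); split; apply: dgmor_eq => i x.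
  by rewrite [RHS]cb /= mfun0 addr0.
by rewrite [RHS]cb /= mfun0 add0r.
Qed.

(** * Morphisms of the derived category *)

#[local] Instance deq_Equivalence (R : cdgring) (M N : dgmod R) : Equivalence (@deq R M N).
Proof.
split; [exact: deq_refl | move=> ? ?; exact: deq_sym | move=> ? ? ?; exact: deq_trans].
Qed.

#[local] Instance Dcomp_Proper (R : cdgring) (M N P : dgmod R) :
  Proper (@deq R N P ==> @deq R M N ==> @deq R M P) (@Dcomp R M N P).
Proof. by move=> phi phi' hphi psi psi'; exact: deq_congr. Qed.

#[local] Hint Resolve deq_refl : core.

Lemma dgcompA (R : cdgring) (M N P Q : dgmod R) (g : dgmor P Q) (h : dgmor N P)
    (k : dgmor M N) :
  dgcomp g (dgcomp h k) = dgcomp (dgcomp g h) k.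
Proof. exact: dgmor_eq. Qed.

Lemma dgcomp1l (R : cdgring) (M N : dgmod R) (g : dgmor M N) : dgcomp (dgid N) g = g.
Proof. exact: dgmor_eq. Qed.

Lemma dgcomp1r (R : cdgring) (M N : dgmod R) (g : dgmor M N) : dgcomp g (dgid M) = g.
Proof. exact: dgmor_eq. Qed.

Lemma deq_cancel_l (R : cdgring) (M N P : dgmod R) (s : dgmor N P) (phi psi : dmor M N) :
  quasi_iso s -> deq (Dcomp (Dmor s) phi) (Dcomp (Dmor s) psi) -> deq phi psi.
Proof.
move=> qs h; rewrite -(deq_id_l phi) -(deq_id_l psi) -(deq_inv_l qs).
rewrite -!deq_assoc h.
exact: deq_refl.
Qed.

Lemma deq_cancel_r (R : cdgring) (M N P : dgmod R) (s : dgmor M N) (phi psi : dmor N P) :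
  quasi_iso s -> deq (Dcomp phi (Dmor s)) (Dcomp psi (Dmor s)) -> deq phi psi.
Proof.
move=> qs h; rewrite -(deq_id_r phi) -(deq_id_r psi) -(deq_inv_r qs).
rewrite !deq_assoc h.
exact: deq_refl.
Qed.

(** The two ends of the cylinder have the same composite with the projection to M; as that is a
    quasi-isomorphism, they agree in the derived category. *)
Lemma homotopic_deq (R : cdgring) (M N : dgmod R) (g g' : dgmor M N) :
  homotopic g g' -> deq (Dmor g) (Dmor g').
Proof.
case/homotopic_cylinder=> c [-> ->].
rewrite (deq_comp c (cylinder_in1 M)) (deq_comp c (cylinder_in2 M)).
apply: deq_congr; first exact: deq_refl.
apply: (deq_cancel_l (cylinder_proj_qi M)); rewrite -!deq_comp.
suff -> : dgcomp (cylinder_proj M) (cylinder_in1 M) =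
          dgcomp (cylinder_proj M) (cylinder_in2 M) by exact: deq_refl.
by apply: dgmor_eq => i x; rewrite /= addr0 add0r.
Qed.

(** A functor to the category of sets and relations which inverts the
    quasi-isomorphisms factors through the derived category. *)

Section Localization.
Variables (R : cdgring) (X : dgmod R -> Type)
  (F : forall M N, dgmor M N -> X M -> X N -> Prop).
Hypothesis F_comp : forall M N P (g : dgmor N P) (h : dgmor M N) a c,
  F (dgcomp g h) a c <-> exists b, F h a b /\ F g b c.
Hypothesis F_qi_l : forall M N (s : dgmor M N), quasi_iso s ->
  forall a a', (exists b, F s a b /\ F s a' b) <-> F (dgid M) a a'.
Hypothesis F_qi_r : forall M N (s : dgmor M N), quasi_iso s ->
  forall b b', (exists a, F s a b /\ F s a b') <-> F (dgid N) b b'.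

(** With relations, [Dinv] is interpreted by the converse relation, with no inverse function to
    construct. The relation [F (dgid M)], in general coarser than equality, serves as the identity
    of [X M]. *)
Fixpoint drel (M N : dgmod R) (phi : dmor M N) : X M -> X N -> Prop :=
  match phi in dmor M N return X M -> X N -> Prop with
  | Dmor M N g => F g
  | Dinv M N s hs => fun b a => F s a b
  | Dcomp M N P phi psi => fun a c => exists b, drel psi a b /\ drel phi b c
  end.

(** Inherited from the left side of [F_qi_l], which is symmetric in [a] and [a']. *)
Let F_id_sym M (a a' : X M) : F (dgid M) a a' -> F (dgid M) a' a.
Proof.
have q := quasi_iso_id M.
by move=> /(F_qi_l q) [b [h h']]; apply/(F_qi_l q); exists b.
Qed.

Lemma drel_id_l M N (phi : dmor M N) a c :
  (exists b, drel phi a b /\ F (dgid N) b c) <-> drel phi a c.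
Proof.
elim: phi a c => [{}M {}N g|{}M {}N s hs|{}M {}N P phi IH1 psi IH2] a c /=.
- by rewrite -F_comp dgcomp1l.
- split=> [[b [h h']]|]; rewrite -{1}[s]dgcomp1r.
    by apply/F_comp; exists b; split=> //; exact: F_id_sym.
  by case/F_comp=> b [h h']; exists b; split=> //; exact: F_id_sym.
- split=> [[b [[d [h1 h2]] h3]]|[d [h1 h2]]].
    by exists d; split=> //; apply/IH1; exists b.
  by case/IH1: h2 => b [h2 h3]; exists b; split=> //; exists d.
Qed.

Lemma drel_id_r M N (phi : dmor M N) a c :
  (exists b, F (dgid M) a b /\ drel phi b c) <-> drel phi a c.
Proof.
elim: phi a c => [{}M {}N g|{}M {}N s hs|{}M {}N P phi IH1 psi IH2] a c /=.
- by rewrite -F_comp dgcomp1r.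
- split=> [[b [h h']]|]; rewrite -{1}[s]dgcomp1l.
    by apply/F_comp; exists b; split=> //; exact: F_id_sym.
  by case/F_comp=> b [h h']; exists b; split=> //; exact: F_id_sym.
- split=> [[b [h1 [d [h2 h3]]]]|[d [h1 h2]]].
    by exists d; split=> //; apply/IH2; exists b.
  by case/IH2: h1 => b [h1 h3]; exists b; split=> //; exists d.
Qed.

Lemma deq_drel M N (phi psi : dmor M N) a b : deq phi psi -> drel phi a b <-> drel psi a b.
Proof.
move=> h; elim: h a b => {M N phi psi} /=.
- by [].
- by move=> M N phi psi _ IH a b; rewrite IH.
- by move=> M N phi psi chi _ IH1 _ IH2 a b; rewrite IH1.
- move=> M N P phi phi' psi psi' _ IH1 _ IH2 a c.
  by split=> -[b [/IH2 h /IH1 h']]; exists b.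
- move=> M N P Q phi psi chi a d.
  by split=> [[c [[b [h1 h2]] h3]]|[b [h1 [c [h2 h3]]]]]; [exists b|exists c];
    split=> //; [exists c|exists b].
- by move=> M N phi a b; exact: drel_id_l.
- by move=> M N phi a b; exact: drel_id_r.
- by move=> M N P g h a b; exact: F_comp.
- by move=> M N s hs a b; exact: F_qi_l.
- by move=> M N s hs a b; exact: F_qi_r.
Qed.

End Localization.

(** * Morphisms into a K-injective module *)

Section ToKInjective.
Variables (R : cdgring) (I : dgmod R) (kI : kinj I).

(** The contravariant functor of homotopy classes of maps to [I], made covariant by reversing the
    graph of precomposition. The two conditions on quasi-isomorphisms come from [kinj_lift] and
    [kinj_inj]. *)
Let F (M N : dgmod R) (g : dgmor M N) (a : dgmor M I) (b : dgmor N I) : Prop :=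
  homotopic a (dgcomp b g).

Let F_comp M N P (g : dgmor N P) (h : dgmor M N) a c :
  F (dgcomp g h) a c <-> exists b, F h a b /\ F g b c.
Proof.
rewrite /F dgcompA; split=> [ac|[b [ab bc]]].
  by exists (dgcomp c g); split=> //; exact: homotopic_refl.
exact: homotopic_trans ab (homotopic_compr h bc).
Qed.

Let F_qi_l M N (s : dgmor M N) : quasi_iso s ->
  forall a a', (exists b, F s a b /\ F s a' b) <-> F (dgid M) a a'.
Proof.
move=> qs a a'; rewrite /F dgcomp1r; split=> [[b [ab a'b]]|aa'].
  exact: homotopic_trans ab (homotopic_sym a'b).
have [b a'b] := kinj_lift a' kI qs.
by exists b; split=> //; exact: homotopic_trans aa' a'b.
Qed.

Let F_qi_r M N (s : dgmor M N) : quasi_iso s ->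
  forall b b', (exists a, F s a b /\ F s a b') <-> F (dgid N) b b'.
Proof.
move=> qs b b'; rewrite /F dgcomp1r; split=> [[a [ab ab']]|bb'].
  exact: (kinj_inj kI qs (homotopic_trans (homotopic_sym ab) ab')).
exists (dgcomp b s); split; first exact: homotopic_refl.
exact: homotopic_compr.
Qed.

(** Yoneda argument: [g] relates the map [g] to the identity of [I]; an equal morphism [g'] does so
    too, which is the homotopy. *)
Lemma deq_kinj (N : dgmod R) (g g' : dgmor N I) :
  deq (Dmor g) (Dmor g') -> homotopic g g'.
Proof.
move=> /(deq_drel F_comp F_qi_l F_qi_r g (dgid I)) /= [h _].
by move: h; rewrite /F !dgcomp1l; apply; exact: homotopic_refl.
Qed.

(** The intermediate objects of a word need not be K-injective, so the induction carries an
    arbitrary map [a] to [I] at the end of the word; an inverse of [s] is absorbed by extending [a]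
    along [s]. *)
Lemma dmor_kinj (N : dgmod R) (phi : dmor N I) : exists g : dgmor N I, deq phi (Dmor g).
Proof.
suff H (M : dgmod R) (psi : dmor N M) (a : dgmor M I) :
    exists g : dgmor N I, deq (Dcomp (Dmor a) psi) (Dmor g).
  have [g hg] := H _ phi (dgid I).
  by exists g; rewrite -hg deq_id_l.
elim: psi a => {phi M} [{}N M g|{}N M s hs|{}N M P phi IH1 psi IH2] a.
- by exists (dgcomp a g); apply: deq_sym; exact: deq_comp.
- have [b ab] := kinj_lift a kI hs; exists b.
  rewrite (homotopic_deq ab) deq_comp -deq_assoc (deq_inv_r hs).
  exact: deq_id_r.
- have [b hb] := IH1 a; have [g hg] := IH2 b; exists g.
  by rewrite deq_assoc hb; exact: hg.
Qed.

End ToKInjective.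

(** * Morphisms out of a K-projective module *)

Section FromKProjective.
Variables (R : cdgring) (P : dgmod R) (kP : kproj P).

Let F (M N : dgmod R) (g : dgmor M N) (a : dgmor P M) (b : dgmor P N) : Prop :=
  homotopic b (dgcomp g a).

Let F_comp M N Q (g : dgmor N Q) (h : dgmor M N) a c :
  F (dgcomp g h) a c <-> exists b, F h a b /\ F g b c.
Proof.
rewrite /F -dgcompA; split=> [ac|[b [ab bc]]].
  by exists (dgcomp h a); split=> //; exact: homotopic_refl.
exact: homotopic_trans bc (homotopic_compl g ab).
Qed.

Let F_qi_l M N (s : dgmor M N) : quasi_iso s ->
  forall a a', (exists b, F s a b /\ F s a' b) <-> F (dgid M) a a'.
Proof.
move=> qs a a'; rewrite /F dgcomp1l; split=> [[b [ab a'b]]|aa'].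
  exact: homotopic_sym (kproj_inj kP qs (homotopic_trans (homotopic_sym ab) a'b)).
exists (dgcomp s a'); split; last exact: homotopic_refl.
exact: homotopic_compl.
Qed.

Let F_qi_r M N (s : dgmor M N) : quasi_iso s ->
  forall b b', (exists a, F s a b /\ F s a b') <-> F (dgid N) b b'.
Proof.
move=> qs b b'; rewrite /F dgcomp1l; split=> [[a [ab ab']]|bb'].
  exact: homotopic_trans ab' (homotopic_sym ab).
have [a ab] := kproj_lift b kP qs.
by exists a; split=> //; exact: homotopic_trans bb' ab.
Qed.

Lemma deq_kproj (N : dgmod R) (g g' : dgmor P N) :
  deq (Dmor g) (Dmor g') -> homotopic g g'.
Proof.
move=> /(deq_drel F_comp F_qi_l F_qi_r (dgid P) g) /= [h _].
move: h; rewrite /F !dgcomp1r => h; apply: h; exact: homotopic_refl.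
Qed.

End FromKProjective.

Lemma boundaryD (C : cplx) i (x y : C i) : boundary x -> boundary y -> boundary (x + y).
Proof.
move=> [j [e [u du]]] [k [e' [v dv]]]; have jk : j = k by lia.
case: k / jk e' v dv => e' v dv; exists j, e, (u + v).
by rewrite dif_add du (eq_irrelevance e e') dv.
Qed.

Lemma boundaryN (C : cplx) i (x : C i) : boundary x -> boundary (- x).
Proof. by move=> [j [e [u du]]]; exists j, e, (- u); rewrite difN du. Qed.

Lemma boundary0 (C : cplx) i : boundary (0 : C i).
Proof. by exists (i - 1), (subrK 1 i), 0; rewrite dif0. Qed.

Lemma boundary_mfun (R : cdgring) (M N : dgmod R) (g : dgmor M N) i (x : M i) :
  boundary x -> boundary (g i x).
Proof. by move=> [j [e [u <-]]]; exists j, e, (g j u); rewrite mfun_dif. Qed.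

Lemma cocycle_mfun (R : cdgring) (M N : dgmod R) (g : dgmor M N) i (x : M i) :
  cocycle x -> cocycle (g i x).
Proof. by move=> cx j e; rewrite -mfun_dif cx mfun0. Qed.

(** * Cohomology in degree zero as an invariant of the derived category *)

Section DegreeZeroCohomology.
Variable R : cdgring.

Let X (M : dgmod R) : Type := {x : M 0 | cocycle x}.

Let F (M N : dgmod R) (g : dgmor M N) (a : X M) (b : X N) : Prop :=
  boundary (sval b - g 0 (sval a)).

Let F_trans (M N : dgmod R) (x y z : M 0) :
  boundary (x - y) -> boundary (y - z) -> boundary (x - z).
Proof. by move=> xy yz; move: (boundaryD xy yz); rewrite addrA addrNK. Qed.

Let F_sym (M N : dgmod R) (x y : M 0) : boundary (x - y) -> boundary (y - x).
Proof. by move=> xy; move: (boundaryN xy); rewrite opprB. Qed.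

Let F_comp M N P (g : dgmor N P) (h : dgmor M N) a c :
  F (dgcomp g h) a c <-> exists b, F h a b /\ F g b c.
Proof.
rewrite /F /=; split=> [ac|[b [ab bc]]].
  exists (exist _ (h 0 (sval a)) (cocycle_mfun h (svalP a))).
  by rewrite /= subrr; split=> //; exact: boundary0.
apply: (F_trans M bc); have := boundary_mfun g ab.
by rewrite mfun_add mfunN.
Qed.

Let F_qi_l M N (s : dgmor M N) : quasi_iso s ->
  forall a a', (exists b, F s a b /\ F s a' b) <-> F (dgid M) a a'.
Proof.
move=> [sinj _] a a'; rewrite /F; split=> [[b [ab a'b]]|aa'].
  apply: sinj.
    by move=> j e; rewrite dif_add difN (svalP a) (svalP a') subrr.
  by rewrite mfun_add mfunN; apply: F_trans ab; [|exact: F_sym].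
exists (exist _ (s 0 (sval a)) (cocycle_mfun s (svalP a))).
rewrite /= subrr; split; first exact: boundary0.
by rewrite -mfunN -mfun_add; apply: boundary_mfun; exact: F_sym.
Qed.

Let F_qi_r M N (s : dgmor M N) : quasi_iso s ->
  forall b b', (exists a, F s a b /\ F s a b') <-> F (dgid N) b b'.
Proof.
move=> [_ ssurj] b b'; rewrite /F; split=> [[a [ab ab']]|bb'].
  by apply: F_trans ab' _; [|exact: F_sym].
have [x [cx bx]] := ssurj _ _ (svalP b).
by exists (exist _ x cx); split=> //; apply: F_trans bb' bx.
Qed.

(** The class of [y] is related to itself by the identity, hence by [t] after its inverse; the
    intermediate class of this composite relation is the preimage. *)
Lemma diso_surj (M N : dgmod R) (t : dgmor M N) : is_diso (Dmor t) ->
  forall y : N 0, cocycle y -> exists x : M 0, cocycle x /\ boundary (y - t 0 x).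
Proof.
move=> [psi [_ h]] y cy; pose b : X N := exist _ y cy.
have [_ h'] := deq_drel F_comp F_qi_l F_qi_r b b h.
have [|[x cx] [_ bx]] := h'.
  by rewrite /= /F /= subrr; exact: boundary0.
by exists x; split=> //.
Qed.

End DegreeZeroCohomology.

(** * Multiplication by a cocycle of degree zero *)

Definition scale_mor (R : cdgring) (M : dgmod R) (b : R 0) (cb : cocycle b) : dgmor M M.
Proof.
exists (fun i x => act (add0r i) b x).
- by move=> i x y; rewrite act_addr.
- move=> i j e x; rewrite (dif_act (add0r i) (add0r 1) e e (etrans (addrC 1 i) e) (add0r j)).
  by rewrite cb act0l add0r mulr1z.
- move=> i j k e a x.
  by rewrite (act_comm e (add0r k) (add0r j) e) mulr0 mulr1z.
Defined.

Lemma scale_mor_natural (R : cdgring) (M N : dgmod R) (g : dgmor M N) (b : R 0)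
    (cb : cocycle b) :
  dgcomp g (scale_mor M cb) = dgcomp (scale_mor N cb) g.
Proof. by apply: dgmor_eq => i x; rewrite /= mfun_act. Qed.

(** Induction on the word; for a formal inverse, the commuting square of [s] is composed with the
    inverse on both sides. *)
Lemma scale_dmor_natural (R : cdgring) (M N : dgmod R) (phi : dmor M N) (b : R 0)
    (cb : cocycle b) :
  deq (Dcomp phi (Dmor (scale_mor M cb))) (Dcomp (Dmor (scale_mor N cb)) phi).
Proof.
elim: phi => {M N} [M N g|M N s qs|M N P phi IH1 psi IH2].
- by rewrite -!deq_comp scale_mor_natural.
- have h : deq (Dcomp (Dmor s) (Dmor (scale_mor M cb))) (Dcomp (Dmor (scale_mor N cb)) (Dmor s)).
    by rewrite -!deq_comp scale_mor_natural.
  apply: (deq_cancel_l qs); rewrite (deq_assoc (Dmor s) (Dinv qs)) (deq_inv_r qs) deq_id_l.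
  by rewrite deq_assoc h -deq_assoc (deq_inv_r qs) deq_id_r.
- by rewrite -deq_assoc IH2 !deq_assoc IH1.
Qed.

Lemma res_scale_mor (R S : cdgring) (f : cdghom R S) (M : dgmod S) (b : R 0) (b' : S 0)
    (cb : cocycle b) (cb' : cocycle b') :
  f 0 b = b' -> res_mor f (scale_mor M cb') = scale_mor (res f M) cb.
Proof. by move=> fb; subst b'; apply: dgmor_eq. Qed.

(** By linearity a scalar [c] acting on the values of a map moves to its argument, where it acts
    through [f]. Taking [f c] to be b^2 is what makes the squaring operation quadratic. *)
Lemma hom_map_scale_mor (R S : cdgring) (f : cdghom R S) (X : dgmod S) (Y : dgmod R)
    (c : R 0) (b : S 0) (cc : cocycle c) (cb : cocycle b) :
  f 0 c = mul (add0r 0) b b ->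
  hom_map f X (scale_mor Y cc) =
  dgcomp (scale_mor (dgHom f X Y) cb) (scale_mor (dgHom f X Y) cb).
Proof.
move=> fc; apply: dgmor_eq => i h; apply: homel_eq => j k e x /=.
have ej : i + (0 + j) = k by lia.
have := hfun_act h (erefl (0 + j)) ej e (add0r k) c x.
rewrite fc mulr0 mulr1z mul0r !mulr1z => <-.
have e3 : 0 + (0 + j) = 0 + j by rewrite add0r.
rewrite (act_assoc (add0r 0) erefl erefl e3).
exact: hfun_act_irr.
Qed.

(** * The Hom functor on homotopies *)

Lemma homactE (R S : cdgring) (f : cdghom R S) (X : dgmod S) (Y : dgmod R) i j k
    (e : i + j = k) (b : S i) (h : homel f X Y j) l m (e' : k + l = m) x :
  hfun (homact e b h) e' x = hfun h (homact_e e e') (act erefl b x) *~ ksign (i * j).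
Proof. by []. Qed.

Lemma hcomp_homact (R S : cdgring) (f : cdghom R S) (X : dgmod S) (Y Y' : dgmod R)
    i a j k aj ak (e1 : a + j = aj) (e2 : i + aj = ak) (e3 : i + j = k)
    (e4 : a + k = ak) (h : homel (cdgid R) Y Y' i) (r : S a) (u : homel f X Y j) :
  hcomp e2 h (homact e1 r u) = homact e4 r (hcomp e3 h u) *~ ksign (i * a).
Proof.
apply: homel_eq => l m el x; rewrite hfunE_sign.
have a1 : aj + l = m - i by lia.
have a2 : i + (m - i) = m by lia.
have a3 : j + (a + l) = m - i by lia.
rewrite (hcompE _ _ _ el a1 a2) homactE (homactE e4) hfun_sign.
rewrite (hcompE _ _ _ _ a3 a2) (eq_irrelevance (homact_e e1 a1) a3) -mulrzA.
by congr (_ *~ _); rewrite -e3 !signE; do 3!case: odd.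
Qed.

(** Hom(X, -) as a DG functor: it is defined on maps of every degree, so that it can be applied to a
    homotopy. *)
Definition hom_map_homel (R S : cdgring) (f : cdghom R S) (X : dgmod S) (Y Y' : dgmod R)
  i (h : homel (cdgid R) Y Y' i) : homel (cdgid S) (dgHom f X Y) (dgHom f X Y') i.
Proof.
exists (fun j k e (u : dgHom f X Y j) => hcomp e h u : dgHom f X Y' k).
- move=> j k e u v; exact: hcompDr.
- move=> a j k aj ak e1 e2 e3 e4 r u; exact: hcomp_homact.
Defined.

Lemma hom_map_homelE (R S : cdgring) (f : cdghom R S) (X : dgmod S) (Y Y' : dgmod R)
    i (h : homel (cdgid R) Y Y' i) j k (e : i + j = k) (u : homel f X Y j) :
  hfun (hom_map_homel f X h) e u = hcomp e h u.
Proof. by []. Qed.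

Lemma homdif_hom_map_homel (R S : cdgring) (f : cdghom R S) (X : dgmod S)
    (Y Y' : dgmod R) i i' (ei : i + 1 = i') (h : homel (cdgid R) Y Y' i) :
  homdif ei (hom_map_homel f X h) = hom_map_homel f X (homdif ei h).
Proof.
apply: homel_eq => j k e u.
have a1 : i + j = k - 1 by lia.
have a2 : i + (j + 1) = k by lia.
rewrite (hfun_dif _ _ _ a1 (subrK 1 k) erefl a2).
rewrite !hom_map_homelE.
rewrite -[dif (subrK 1 k) _]/(homdif (subrK 1 k) (hcomp a1 h u)).
by rewrite (homdif_hcomp a1 ei erefl (subrK 1 k) e a2) addrK.
Qed.

Lemma hom_of_hom_map (R S : cdgring) (f : cdghom R S) (X : dgmod S) (Y Y' : dgmod R)
    (g : dgmor Y Y') :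
  hom_of (hom_map f X g) = hom_map_homel f X (hom_of g).
Proof.
apply: homel0_eq => i e u; rewrite hom_ofE hom_map_homelE.
apply: homel_eq => j k ej x.
by rewrite (hcompE _ _ _ ej ej (add0r k)) hom_ofE.
Qed.

Lemma homotopic_hom_map (R S : cdgring) (f : cdghom R S) (X : dgmod S) (Y Y' : dgmod R)
    (g g' : dgmor Y Y') :
  homotopic g g' -> homotopic (hom_map f X g) (hom_map f X g').
Proof.
case=> h dh; exists (hom_map_homel f X h).
rewrite homdif_hom_map_homel dh !hom_of_hom_map.
by apply: homel_eq => j k e u; rewrite hfunE_add hfunE_opp !hom_map_homelE hcompDl hcompNl.
Qed.

Lemma dres_deq (R S : cdgring) (f : cdghom R S) (M N : dgmod S) (phi psi : dmor M N) :
  deq phi psi -> deq (dres f phi) (dres f psi).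
Proof.
have res_id (L : dgmod S) : res_mor f (dgid L) = dgid (res f L) by exact: dgmor_eq.
elim=> {M N phi psi} //=.
- by move=> M N phi psi _; exact: deq_sym.
- by move=> M N phi psi chi _ h _ h'; exact: deq_trans h h'.
- by move=> M N P phi phi' psi psi' _ h _ h'; exact: deq_congr.
- by move=> *; exact: deq_assoc.
- by move=> *; rewrite res_id; exact: deq_id_l.
- by move=> *; rewrite res_id; exact: deq_id_r.
- move=> M N P g h; rewrite -deq_comp.
  suff -> : res_mor f (dgcomp g h) = dgcomp (res_mor f g) (res_mor f h) by exact: deq_refl.
  exact: dgmor_eq.
- by move=> M N s hs; rewrite res_id; exact: deq_inv_l.
- by move=> M N s hs; rewrite res_id; exact: deq_inv_r.
Qed.

(** * Homotopies between tensor squares *)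

Section Tensor.
Variables (A : cdgring) (M N : dgmod A) (T : cplx) (t : tensor M N T).

Lemma tens0l i j k (e : i + j = k) (y : N j) : 0 ⊗[t, e] y = 0.
Proof. by apply: (addIr (0 ⊗[t, e] y)); rewrite -bfun_addl !add0r. Qed.

Lemma tens0r i j k (e : i + j = k) (x : M i) : x ⊗[t, e] 0 = 0.
Proof. by apply: (addIr (x ⊗[t, e] 0)); rewrite -bfun_addr !add0r. Qed.

Lemma tensNl i j k (e : i + j = k) (x : M i) (y : N j) :
  (- x) ⊗[t, e] y = - (x ⊗[t, e] y).
Proof. by apply: (addIr (x ⊗[t, e] y)); rewrite -bfun_addl !addNr tens0l. Qed.

Lemma tensNr i j k (e : i + j = k) (x : M i) (y : N j) :
  x ⊗[t, e] (- y) = - (x ⊗[t, e] y).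
Proof. by apply: (addIr (x ⊗[t, e] y)); rewrite -bfun_addr !addNr tens0r. Qed.

Lemma tens_signl i j k (e : i + j = k) (x : M i) (y : N j) n :
  (x *~ ksign n) ⊗[t, e] y = (x ⊗[t, e] y) *~ ksign n.
Proof. by rewrite ksignE; case: odd; rewrite ?mulrN1z ?mulr1z ?tensNl. Qed.

Lemma tens_signr i j k (e : i + j = k) (x : M i) (y : N j) n :
  x ⊗[t, e] (y *~ ksign n) = (x ⊗[t, e] y) *~ ksign n.
Proof. by rewrite ksignE; case: odd; rewrite ?mulrN1z ?mulr1z ?tensNr. Qed.

Definition concentrate k (G : zmodType) (u : T k -> G) (l : int) (z : T l) : G :=
  match l =P k with
  | ReflectT e => u (ecast l (T l) e z)
  | ReflectF _ => 0
  end.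

Lemma concentrate_id k (G : zmodType) (u : T k -> G) z : concentrate u z = u z.
Proof. by rewrite /concentrate; case: eqP => // e; rewrite eq_axiomK. Qed.

Lemma concentrate_add k (G : zmodType) (u : T k -> G) :
  {morph u : x y / x + y} -> forall l, {morph @concentrate k G u l : x y / x + y}.
Proof.
move=> hu l x y; rewrite /concentrate; case: eqP => [e|_]; last by rewrite addr0.
by subst l; rewrite hu.
Qed.

(* The universal property concerns families of maps; the maps on the degree [k]
   component alone are extended by zero to the other degrees. *)
Lemma tens_ext k (G : zmodType) (u v : T k -> G) :
  {morph u : x y / x + y} -> {morph v : x y / x + y} ->
  (forall i j (e : i + j = k) x y, u (x ⊗[t, e] y) = v (x ⊗[t, e] y)) ->
  forall z, u z = v z.
Proof.
move=> hu hv uv z.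
pose b i j l (e : i + j = l) x y := concentrate u (x ⊗[t, e] y).
have b_addl i j l (e : i + j = l) x y y' : b i j l e (x + y) y' = b i j l e x y' + b i j l e y y'.
  by rewrite /b bfun_addl concentrate_add.
have b_addr i j l (e : i + j = l) x y y' : b i j l e x (y + y') = b i j l e x y + b i j l e x y'.
  by rewrite /b bfun_addr concentrate_add.
have sgn l n : {morph @concentrate k G u l : x / x *~ ksign n}.
  move=> x; rewrite ksignE; case: odd; rewrite ?mulrN1z ?mulr1z //.
  have c0 : concentrate u (0 : T l) = 0.
    by apply: (addIr (concentrate u (0 : T l))); rewrite -concentrate_add // !add0r.
  by apply: (addIr (concentrate u x)); rewrite -concentrate_add // !addNr c0.
have b_bal a i j ai aj l (e1 : a + i = ai) (e2 : a + j = aj) (e3 : ai + j = l)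
    (e4 : i + aj = l) (r : A a) x y :
  b ai j l e3 (act e1 r x) y = b i aj l e4 x (act e2 r y) *~ ksign (a * i).
  by rewrite /b (bfun_bal _ e1 e2 e3 e4) sgn.
have [h [_ h_uniq]] := tens_univ t (G := fun=> G) (Bimap b_addl b_addr b_bal).
rewrite -(concentrate_id u) -(concentrate_id v).
rewrite (h_uniq (fun l z => concentrate u z)) ?(h_uniq (fun l z => concentrate v z)) //.
  split=> [l x y|i j l e x y]; first exact: concentrate_add.
  rewrite /= /b /concentrate; case: eqP => // e'.
  have -> : ecast l (T l) e' (x ⊗[t, e] y) = x ⊗[t, etrans e e'] y by case: _ / e'.
  by rewrite uv.
by split=> // l x y; exact: concentrate_add.
Qed.

End Tensor.

Fact odd_absN1 : odd `|-1 : int|%N. Proof. by []. Qed.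

Section TensorHomotopy.
Variables (R S : cdgring) (f : cdghom R S) (E : tensor_ring f) (P Q : dgmod S)
  (TP : tensor_sq E P) (TQ : tensor_sq E Q) (g g' : dgmor P Q)
  (h : homel (cdgid S) P Q (-1)).
Local Notation tP := (tsq_tens TP).
Local Notation tQ := (tsq_tens TQ).

Fact tens_homotopy_e1 (i j k : int) : i + j = k -> -1 + i + j = -1 + k.
Proof. by lia. Qed.
Fact tens_homotopy_e2 (i j k : int) : i + j = k -> i + (-1 + j) = -1 + k.
Proof. by lia. Qed.

(** From g ⊗ g - g' ⊗ g' = (g - g') ⊗ g + g' ⊗ (g - g') comes the homotopy h ⊗ g + g' ⊗ h. The sign
    appears when [h], of degree -1, passes [x]. *)
Definition tens_homotopy_bimap : bimap (res f P) (res f P) (fun k => TQ (-1 + k)).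
Proof.
apply: (@Bimap R (res f P) (res f P) _ (fun i j k e x y =>
  hfun h erefl x ⊗[tQ, tens_homotopy_e1 e] g j y +
  (g' i x ⊗[tQ, tens_homotopy_e2 e] hfun h erefl y) *~ ksign i)).
- move=> i j k e x y z; rewrite hfun_add mfun_add !bfun_addl mulrzDl.
  by rewrite addrACA.
- move=> i j k e x y z; rewrite hfun_add mfun_add !bfun_addr mulrzDl.
  by rewrite addrACA.
- move=> a i j ai aj k e1 e2 e3 e4 r x y.
  have a1 : a + (-1 + i) = -1 + ai by lia.
  have a2 : a + (-1 + j) = -1 + aj by lia.
  rewrite (hfun_act h e1 erefl erefl a1) (hfun_act h e2 erefl erefl a2).
  rewrite !mfun_act tens_signl tens_signr.
  have b1 := bfun_bal (tens tQ) a1 e2 (tens_homotopy_e1 e3) (tens_homotopy_e1 e4) r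
    (hfun h erefl x) (g j y).
  have b2 := bfun_bal (tens tQ) e1 a2 (tens_homotopy_e2 e3) (tens_homotopy_e2 e4) r
    (g' i x) (hfun h erefl y).
  rewrite /= in b1 b2; rewrite b1 b2 mulrzDl -!mulrzA.
  by congr (_ *~ _ + _ *~ _); rewrite -?e1 !signE odd_absN1; do 2!case: odd.
Defined.

Lemma tens_homotopy_ex : exists H : homel (cdgid E) TP TQ (-1),
  forall i j k l i' j' (e : i + j = k) (el : -1 + k = l) (ei : -1 + i = i')
    (ej : -1 + j = j') (e1 : i' + j = l) (e2 : i + j' = l) (x : P i) (y : P j),
  hfun H el (x ⊗[tP, e] y) =
  hfun h ei x ⊗[tQ, e1] g j y + (g' i x ⊗[tQ, e2] hfun h ej y) *~ ksign i.
Proof.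
have [H0 [[H0_add H0_val] _]] := tens_univ tP tens_homotopy_bimap.
(* The universal property only gives values in degrees of the form [-1 + j]; the cast moves them to
   an arbitrary equal degree. *)
pose H j k (e : -1 + j = k) (z : TP j) : TQ k := ecast k (TQ k) e (H0 j z).
have H_add j k (e : -1 + j = k) z z' : H j k e (z + z') = H j k e z + H j k e z'.
  by rewrite /H; case: k / e; rewrite H0_add.
have H_val i j k l i' j' (e : i + j = k) (el : -1 + k = l) (ei : -1 + i = i')
    (ej : -1 + j = j') (e1 : i' + j = l) (e2 : i + j' = l) (x : P i) (y : P j) :
  H k l el (x ⊗[tP, e] y) =
  hfun h ei x ⊗[tQ, e1] g j y + (g' i x ⊗[tQ, e2] hfun h ej y) *~ ksign i.
  case: l / el e1 e2 => e1 e2; case: i' / ei e1 => e1; case: j' / ej e2 => e2.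
  rewrite /H H0_val /= (eq_irrelevance e1 (tens_homotopy_e1 e)).
  by rewrite (eq_irrelevance e2 (tens_homotopy_e2 e)).
have H_sgn j k (e : -1 + j = k) z n : H j k e (z *~ ksign n) = H j k e z *~ ksign n.
  have H_0 : H j k e 0 = 0 by apply: (addIr (H j k e 0)); rewrite -H_add !add0r.
  rewrite ksignE; case: odd; rewrite ?mulrN1z ?mulr1z //.
  by apply: (addIr (H j k e z)); rewrite -H_add !addNr H_0.
have H_act a j k aj ak (e1 : a + j = aj) (e2 : -1 + aj = ak) (e3 : -1 + j = k)
    (e4 : a + k = ak) (r : E a) (z : TP j) :
  H aj ak e2 (act e1 r z) = act e4 r (H j k e3 z) *~ ksign (-1 * a).
  (* Linearity over [E] is additive in the scalar and in the vector, so it is reduced to pure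
     tensors twice, first in [r] and then in [z]. *)
  refine (tens_ext (t := tring_tens E)
    (u := fun r => H aj ak e2 (act e1 r z))
    (v := fun r => act e4 r (H j k e3 z) *~ ksign (-1 * a)) _ _ _ r).
  - by move=> x y; rewrite act_addl H_add.
  - by move=> x y; rewrite act_addl mulrzDl.
  move=> p q epq b c.
  refine (tens_ext (t := tP)
    (u := fun z => H aj ak e2 (act e1 (b ⊗[tring_tens E, epq] c) z))
    (v := fun z => act e4 (b ⊗[tring_tens E, epq] c) (H j k e3 z) *~ ksign (-1 * a)) _ _ _ z).
  - by move=> x y; rewrite act_addr H_add.
  - by move=> x y; rewrite H_add act_addr mulrzDl.
  move=> m n emn x y.
  have a1 : (p + m) + (q + n) = aj by lia.
  have a2 : p + (-1 + m) = -1 + (p + m) by lia.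
  have a3 : q + (-1 + n) = -1 + (q + n) by lia.
  have a4 : -1 + (p + m) + (q + n) = ak by lia.
  have a5 : p + m + (-1 + (q + n)) = ak by lia.
  have a6 : -1 + m + n = k by lia.
  have a7 : m + (-1 + n) = k by lia.
  rewrite (tsq_act TP epq emn erefl erefl e1 a1) H_sgn.
  rewrite (H_val _ _ _ _ _ _ a1 e2 erefl erefl a4 a5).
  rewrite (H_val _ _ _ _ _ _ emn e3 erefl erefl a6 a7).
  rewrite (hfun_act h (erefl (p + m)) erefl erefl a2).
  rewrite (hfun_act h (erefl (q + n)) erefl erefl a3) !mfun_act.
  rewrite tens_signl tens_signr act_addr act_sign.
  rewrite (tsq_act TQ epq a6 a2 erefl e4 a4) (tsq_act TQ epq a7 erefl a3 e4 a5).
  rewrite !mulrzDl -!mulrzA.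
  by congr (_ *~ _ + _ *~ _); rewrite -?epq !signE ?odd_absN1; do 3!case: odd.
by exists (Homel (f := cdgid E) (X := TP) (Y := TQ) H_add H_act).
Qed.

Lemma tens_homotopic (F F' : dgmor TP TQ) :
  is_tensor_sq_mor g F -> is_tensor_sq_mor g' F' ->
  homdif (addNr 1) h = hom_of g - hom_of g' -> homotopic F F'.
Proof.
move=> hF hF' dh; have [H H_val] := tens_homotopy_ex; exists H.
apply: homel0_eq => k e z; rewrite hfunE_add hfunE_opp !hom_ofE.
refine (tens_ext (t := tP) (u := fun z => hfun (homdif (addNr 1) H) e z)
  (v := fun z => F k z - F' k z) _ _ _ z).
- by move=> x y; rewrite hfun_add.
- by move=> x y; rewrite !mfun_add opprD addrACA.
move=> i j eij x y.
have hE l (w : P l) (a1 : -1 + l = l - 1) (a2 : -1 + (l + 1) = l) :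
  g l w = dif (subrK 1 l) (hfun h a1 w) + hfun h a2 (dif erefl w) + g' l w.
  rewrite -(hom_ofE g (add0r l)) -(hom_ofE g' (add0r l)).
  rewrite -[hom_of g](subrK (hom_of g')) -dh.
  rewrite hfunE_add (hfun_dif _ _ _ a1 (subrK 1 l) erefl a2) mulrN1z opprK //.
have a1 : -1 + k = k - 1 by lia.
have a2 : -1 + (k + 1) = k by lia.
have c1 : -1 + i = i - 1 by lia.
have c2 : -1 + j = j - 1 by lia.
have c3 : -1 + (i + 1) = i by lia.
have c4 : -1 + (j + 1) = j by lia.
have d1 : i - 1 + j = k - 1 by lia.
have d2 : i + (j - 1) = k - 1 by lia.
have d3 : i + 1 + j = k + 1 by lia.
have d4 : i + (j + 1) = k + 1 by lia.
have d5 : i + 1 + (j - 1) = k by lia.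
have d6 : i - 1 + (j + 1) = k by lia.
rewrite (hfun_dif _ _ _ a1 (subrK 1 k) erefl a2) mulrN1z opprK.
rewrite (H_val _ _ _ _ _ _ eij a1 c1 c2 d1 d2) dif_add dif_sign.
rewrite (tens_dif tQ d1 (subrK 1 i) erefl (subrK 1 k) eij d6).
rewrite (tens_dif tQ d2 erefl (subrK 1 j) (subrK 1 k) d5 eij).
rewrite (tens_dif tP eij erefl erefl erefl d3 d4) hfun_add hfun_sign.
rewrite (H_val _ _ _ _ _ _ d3 a2 c3 c2 eij d5) (H_val _ _ _ _ _ _ d4 a2 c1 c4 d6 eij).
rewrite hF hF' !mfun_dif.
have -> : g i x ⊗[tQ, eij] g j y - g' i x ⊗[tQ, eij] g' j y =
    dif (subrK 1 i) (hfun h c1 x) ⊗[tQ, eij] g j y +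
    hfun h c3 (dif erefl x) ⊗[tQ, eij] g j y +
    (g' i x ⊗[tQ, eij] dif (subrK 1 j) (hfun h c2 y) +
    g' i x ⊗[tQ, eij] hfun h c4 (dif erefl y)).
  (* One factor is expanded at a time: the left one leaves g' x ⊗ g y, whose expansion on the right
     leaves the term that cancels g' x ⊗ g' y. *)
  rewrite {1}(hE i x c1 c3) !bfun_addl -addrA; congr (_ + _).
  by rewrite {1}(hE j y c2 c4) !bfun_addr addrK.
(* The cross terms [p] and [q], which are h x ⊗ d (g y) and d (g' x) ⊗ h y, each occur twice with
   opposite signs; the other four terms match. *)
move: (dif _ (hfun h c1 x) ⊗[tQ, eij] _) (hfun h c1 x ⊗[tQ, d6] _)
  (dif _ _ ⊗[tQ, d5] _) (_ ⊗[tQ, eij] dif _ (hfun h c2 y))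
  (hfun h c3 _ ⊗[tQ, eij] _) (_ ⊗[tQ, eij] hfun h c4 _) => u p q w v z'.
rewrite !signE; case: odd; rewrite /= ?(mulrN1z, mulr1z, opprD, opprK).
  by rewrite [LHS](AC ((2*2)*(2*2)) ((1*5*(4*8))*((2*7)*(6*3)))) /= !addrN !addr0.
by rewrite [LHS](AC ((2*2)*(2*2)) ((1*5*(4*8))*((7*2)*(3*6)))) /= !addrN !addr0.
Qed.

End TensorHomotopy.

(** * Rigidity *)

(** The quasi-isomorphism lifts [b] only up to a boundary d y; lifting y as well turns this into a
    lift on the nose. *)
Lemma lift_cocycle (R S : cdgring) (f : cdghom R S) i (b : S i) :
  quasi_iso f -> (forall i (y : S i), exists x : R i, f i x = y) -> cocycle b ->
  exists b' : R i, cocycle b' /\ f i b' = b.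
Proof.
move=> [_ fsurj] surj cb; have [x [cx [j [e [y dy]]]]] := fsurj _ _ cb.
have [y' fy'] := surj _ y; exists (x + dif e y'); split.
  by move=> k e'; rewrite dif_add cx dif_dif addr0.
by rewrite rfun_add rfun_dif fy' dy addrC subrK.
Qed.

(** After composition with M -> J, [phi] is represented by a morphism, that is, by a 0-cocycle of
    Hom(M, J). Up to a boundary it is the image of some [b], and a boundary here is a homotopy. *)
Lemma adjunction_scale_mor (R : cdgring) (M : dgmod R) (J : kinj_resolution M) :
  is_diso (adjunction J) ->
  forall phi : dmor M M, exists (b : R 0) (cb : cocycle b), deq phi (Dmor (scale_mor M cb)).
Proof.
move=> adj phi.
have [g hg] := dmor_kinj (@kinj_kinj _ _ J) (Dcomp (Dmor (kinj_map J)) phi).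
have cg : cocycle (hom_of g : RHom M J 0).
  by move=> j e; exact: homdif_hom_of.
have [b [cb [j [e [h dh]]]]] := diso_surj adj cg.
exists b, cb; apply: (deq_cancel_l (kinj_qi J)); rewrite hg -deq_comp.
apply: homotopic_deq.
have ej : j = -1 by lia.
subst j; exists h; rewrite (eq_irrelevance (addNr 1) e).
transitivity (hom_of g - adjunction_el (kinj_map J) b); first exact: dh.
congr (_ - _); apply: homel0_eq => i ei x.
by rewrite hom_ofE /= (eq_irrelevance ei (add0r i)).
Qed.

Section Squaring.
Variables (A B : cdgring) (f : cdghom A B) (K : kflat_ring_resolution f)
  (E : enveloping K).

(** [is_Sq_mor] does not fix the representatives [g] and [k]. K-projectivity and K-injectivity
    determine them up to homotopy, so they can be exchanged for explicit scalings. *)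
Lemma Sq_scale_mor (M : dgmod B) (S : sq_resolution E M) (b : B 0) (cb : cocycle b)
    (phi : dmor M M) (psi : dmor (Sq S) (Sq S)) :
  deq phi (Dmor (scale_mor M cb)) -> is_Sq_mor phi psi ->
  deq psi (Dmor (dgcomp (scale_mor (Sq S) cb) (scale_mor (Sq S) cb))).
Proof.
move=> hphi [chi [[g [F [hg hF hchi]]] [k [hk hpsi]]]].
have [b' [cb' wb']] := lift_cocycle (rw_qi K) (@rw_surj _ _ _ K) cb.
pose s := kproj_map (sq_proj S); pose q := kflat_map (sq_flat S).
have gs : homotopic g (dgcomp (scale_mor _ cb') s).
  apply: (deq_kproj (@kproj_kproj _ _ (sq_proj S))).
  apply: (deq_cancel_l (kflat_qi (sq_flat S))).
  rewrite hg (dres_deq (rw K) hphi) /= (res_scale_mor _ cb' cb wb') -!deq_comp.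
  by rewrite !dgcompA (scale_mor_natural q).
(* This scalar multiplies both factors of a tensor square by [b'], without sign since [b'] has
   degree 0, and its image in [B] is b^2. *)
pose c : E 0 := b' ⊗[tring_tens E, addr0 0] b'.
have cc : cocycle c.
  move=> j e; have e1 : 1 + 0 = j by lia.
  have e2 : 0 + 1 = j by lia.
  rewrite /c (tens_dif _ _ (add0r 1) (add0r 1) e e1 e2) /= !cb'.
  by rewrite tens0l tens0r mul0rz addr0.
have c_mul : env_mul E 0 c = mul (add0r 0) b b.
  by rewrite /c env_mulE wb' (eq_irrelevance (addr0 0) (add0r 0)).
have hF' : is_tensor_sq_mor (dgcomp (scale_mor _ cb') s)
    (dgcomp (scale_mor (sq_tens S) cc) (sq_proj_sq S)).
  move=> i j l e x y; rewrite /= sq_proj_sqE.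
  rewrite (tsq_act _ (addr0 0) e (add0r i) (add0r j) (add0r l) e).
  by rewrite mul0r mulr1z.
have [h dh] := gs.
have chiE : deq chi (Dmor (scale_mor (sq_tens S) cc)).
  rewrite hchi (homotopic_deq (tens_homotopic hF hF' dh)) deq_comp -deq_assoc.
  by rewrite (deq_inv_r (sq_proj_sq_qi S)) deq_id_r.
have kE : homotopic k (scale_mor (sq_inj S) cc).
  apply: (deq_kinj (@kinj_kinj _ _ (sq_inj S))).
  apply: (deq_cancel_r (kinj_qi (sq_inj S))).
  by rewrite hk chiE -!deq_comp scale_mor_natural.
rewrite hpsi (homotopic_deq (homotopic_hom_map _ _ kE)).
by rewrite (hom_map_scale_mor _ _ cc cb c_mul).
Qed.

(** The identity of M is represented on P by the resolution map s, and s ⊗ s followed after its own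
    inverse is the identity. *)
Lemma Sq_id (M : dgmod B) (S : sq_resolution E M) (phi : dmor M M) :
  deq phi (Did M) -> is_Sq_mor phi (Did (Sq S)).
Proof.
move=> hphi; exists (Did (sq_tens S)); split.
  exists (kproj_map (sq_proj S)), (sq_proj_sq S); split.
  - rewrite (dres_deq (rw K) hphi) /=.
    suff -> : res_mor (rw K) (dgid M) = dgid _ by rewrite deq_id_l.
    exact: dgmor_eq.
  - exact: sq_proj_sqE.
  - by rewrite (deq_inv_r (sq_proj_sq_qi S)).
exists (dgid _); split; first by rewrite deq_id_l deq_id_r.
suff -> : hom_map (env_mul E) (self_mod B) (dgid (sq_inj S)) = dgid _ by [].
by apply: dgmor_eq => i h; exact: homel_eq.
Qed.

End Squaring.

Theorem theorem0p10 (A B : cdgring) (f : cdghom A B)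
    (K : kflat_ring_resolution f) (E : enveloping K)
    (M : rigid E) (J : kinj_resolution M) :
  is_diso (adjunction J) ->
  forall phi : dmor M M, rigid_automorphism phi <-> deq phi (Did M).
Proof.
move=> adj phi; split=> [[[psi [hpsi hrho]] [phi' [phi'K _]]]|hphi].
  have [b [cb hb]] := adjunction_scale_mor adj phi.
  have psiE := Sq_scale_mor hb hpsi.
  have [rho' [rhoK _]] := rig_isoP M.
  have phi_idem : deq phi (Dcomp phi phi).
    rewrite -[X in deq X _]deq_id_l -rhoK -deq_assoc hrho psiE deq_comp.
    rewrite -deq_assoc -scale_dmor_natural deq_assoc -scale_dmor_natural.
    by rewrite -hb !deq_assoc rhoK deq_id_l.
  by rewrite -phi'K [X in deq _ (Dcomp _ X)]phi_idem deq_assoc phi'K deq_id_l.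
split; last by exists (Did M); rewrite hphi deq_id_l.
exists (Did _); split; first exact: Sq_id.
by rewrite hphi deq_id_l deq_id_r.
Qed.
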